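(* Let $I\subset\mathbb{R}$ be a bounded interval, $1<p<\infty$, $\delta\ge 1$, and $w\in RH_p^{\delta}(I)$. Let $q^*=q^*(p,\delta)$ be the critical exponent defined in the context. (i) For every $q\in(1,\infty)$, $$\sup_{J\subset I}\ \langle w\rangle_J\,\langle w^{1-q'}\rangle_J^{\,q-1}\le C_q(p,\delta),\qquad C_q(p,\delta)=\begin{cases}+\infty, & 1<q\le q^*(p,\delta),\\[2pt] \dfrac{1}{q^*}\left(\dfrac{q-1}{q-q^*}\right)^{q-1}, & q>q^*(p,\delta).\end{cases}$$ (ii) $$\sup_{J\subset I}\ \langle w\rangle_J\exp\bigl(-\langle \log w\rangle_J\bigr)\le C_\infty(p,\delta),\qquad C_\infty(p,\delta)=\frac{1}{q^*}\exp(q^*-1).$$ Here the suprema are over all subintervals $J\subset I$. Moreover, the constants $C_q(p,\delta)$ and $C_\infty(p,\delta)$ are best possible: for fixed $I,p,\delta$ (and $q$), no smaller constant makes the corresponding inequality hold for all $w\in RH_p^{\delta}(I)$.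
   Context: A weight on an interval $I$ is a non-negative measurable function on $I$. For a (bounded, non-degenerate) interval $J$, $|J|$ is its length and $\langle f\rangle_J=\frac{1}{|J|}\int_J f(t)\,dt$. The conjugate exponent of $q\in(1,\infty)$ is $q'=\frac{q}{q-1}$. Negative powers of $0$ are $+\infty$. For $1<p<\infty$ and $\delta\ge1$, $RH_p^{\delta}(I)$ is the class of weights $w$ on $I$ such that $0<\langle w\rangle_J<\infty$ and $\dfrac{\langle w^p\rangle_J^{1/p}}{\langle w\rangle_J}\le\delta$ for every subinterval $J\subset I$. For $\delta>1$, $q^*(p,\delta)$ is the unique solution $x>1$ of $\dfrac{(x/\delta)^p-1}{x-1}=p$; for $\delta=1$, $q^*(p,1)=1$. *)

(* Defs.v *)
From HB Require Import structures.
From mathcomp Require Import all_boot all_order all_algebra.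
From mathcomp Require Import all_classical all_reals all_analysis.
From mathcomp Require Import ring lra.

Set Implicit Arguments.
Unset Strict Implicit.
Unset Printing Implicit Defensive.

Import Order.TTheory GRing.Theory Num.Theory.
Import numFieldNormedType.Exports.

Local Open Scope classical_set_scope.
Local Open Scope ring_scope.

(* The line with its Lebesgue (not merely Borel) measurable sets, on which
   [completed_lebesgue_measure] is defined. *)
Definition lebesgue_line (R : realType) :=
  caratheodory_type ((@wlength R idfun)^*)%mu.

Section Definitions.
Context {R : realType}.
Implicit Types (I J : set R) (w : R -> R) (p q delta x : R).

Local Notation leb := (@completed_lebesgue_measure R).

Definition bounded_interval J : Prop :=
  [/\ is_interval J, bounded_set J & exists x y, [/\ J x, J y & x < y]].

Definition subinterval I J : Prop := bounded_interval J /\ J `<=` I.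

Definition average (f : R -> \bar R) J : \bar R :=
  ((\int[leb]_(t in J) f t) / leb J)%E.

Definition weight I w : Prop :=
  @measurable_fun _ _ (lebesgue_line R) (measurableTypeR R) I w
  /\ forall t, I t -> 0 <= w t.

(* [powR] has 0 `^ r = 0 for r < 0; here negative powers of 0 are +oo. *)
Definition epow x r : \bar R :=
  if (x == 0) && (r < 0) then +oo%E else (x `^ r)%:E.

Definition reverse_holder p delta I w : Prop :=
  weight I w /\ forall J, subinterval I J ->
    (0 < average (EFin \o w) J < +oo)%E /\
    (average (fun t => epow (w t) p) J `^ p^-1 / average (EFin \o w) J
       <= delta%:E)%E.

Definition conjugate_exponent q : R := q / (q - 1).

(* The defining equation has no solution x > 1 when delta = 1; when
   1 < delta the solution is unique by [critical_exponent_unique]. *)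
Definition critical_equation p delta : set R :=
  [set x | 1 < x /\ ((x / delta) `^ p - 1) / (x - 1) = p].

Definition critical_exponent p delta : R :=
  if delta == 1 then 1 else xget 1 (critical_equation p delta).

Definition Aq_constant I q w : \bar R :=
  ereal_sup [set (average (EFin \o w) J *
    average (fun t => epow (w t) (1 - conjugate_exponent q)%R) J `^ (q - 1))%E
    | J in subinterval I].

(* [lne 0 = -oo] and [expeR +oo = +oo], so zeros of w are accounted for. *)
Definition Ainfty_constant I w : \bar R :=
  ereal_sup [set (average (EFin \o w) J *
    expeR (- average (fun t => lne (w t)%:E) J))%E
    | J in subinterval I].

Definition Cq p delta q : \bar R :=
  let qs := critical_exponent p delta in
  if q <= qs then +oo%E
  else (qs^-1 * ((q - 1) / (q - qs)) `^ (q - 1))%:E.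

Definition Cinfty p delta : \bar R :=
  let qs := critical_exponent p delta in (qs^-1 * expR (qs - 1))%:E.

Lemma critical_exponent_unique p delta : 1 < p -> 1 < delta ->
  exists! x, critical_equation p delta x.
Proof.
move=> p1 d1.
have d0 : 0 < delta by lra.
have p0 : 0 < p by lra.
pose h x : R := (x / delta) `^ p - 1 - p * (x - 1).
have rootE x : 1 < x ->
    (h x = 0 <-> ((x / delta) `^ p - 1) / (x - 1) = p).
  move=> x1; have x10 : x - 1 != 0 by rewrite subr_eq0 gt_eqF.
  split=> [/subr0_eq ->|/(congr1 ( *%R^~ (x - 1)))]; first by rewrite mulfK.
  by rewrite divfK// /h => ->; rewrite subrr.
have h1 : h 1 < 0.
  rewrite /h subrr mulr0 subr0 subr_lt0 div1r.
  have -> : (1 : R) = 1 `^ p by rewrite powR1.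
  apply: gt0_ltr_powR => //; rewrite ?nnegrE ?invr_ge0 ?ltW//.
  by rewrite invf_lt1.
have [b b1 hb] : exists2 b, 1 < b & 0 < h b.
  have p10 : 0 < p - 1 by lra.
  pose r := (p - 1)^-1.
  have r0 : 0 < r by rewrite invr_gt0.
  pose c := p * delta `^ p.
  have dp1 : 1 < delta `^ p.
    have <- : (1 : R) `^ p = 1 by rewrite powR1.
    by apply: gt0_ltr_powR => //; rewrite ?nnegrE// ltW.
  have c1 : 1 < c by rewrite -[1]mulr1 ltr_pM.
  have b1 : 1 < c `^ r.
    have <- : (1 : R) `^ r = 1 by rewrite powR1.
    by apply: gt0_ltr_powR => //; rewrite ?nnegrE// ltW// (lt_trans _ c1).
  exists (c `^ r) => //.
  have b0 : 0 < c `^ r by lra.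
  have c0 : 0 < c by lra.
  have E : (c `^ r / delta) `^ p = p * c `^ r.
    rewrite powRM ?invr_ge0 ?ltW// -(powRrM c).
    have -> : r * p = 1 + r by rewrite /r; field; rewrite gt_eqF.
    have -> : c `^ (1 + r) = c * c `^ r.
      by rewrite powRD ?powRr1 ?ltW// (gt_eqF c0) implybT.
    have -> : delta^-1 `^ p = (delta `^ p)^-1.
      by rewrite -powR_inv1 ?ltW// -powRrM mulN1r powRN.
    rewrite /c; field; by rewrite gt_eqF// powR_gt0.
  by rewrite /h E; lra.
have cvxh x : 1 < x -> h x = 0 -> forall y, x < y -> h y != 0.
  move=> x1 hx y xy; apply/eqP => hy.
  pose t := (y - x) / (y - 1).
  have t01 : 0 <= t <= 1.
    by rewrite /t divr_ge0 ?ler_pdivrMr /=; lra.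
  pose T : {i01 R} := Itv01 (andP t01).1 (andP t01).2.
  have := @convex_powR R p (ltW p1) T (1 / delta) (y / delta).
  rewrite !inE/= !in_itv/= !andbT !divr_ge0; [|lra..].
  move=> /(_ isT isT).
  rewrite convRE [X in X `^ _ <= _]convRE/= /unstable.onem.
  have -> : t * (1 / delta) + (1 - t) * (y / delta) = x / delta.
    by rewrite /t; field; rewrite !gt_eqF//; lra.
  move=> le.
  have tx : t * (y - 1) = y - x by rewrite /t divfK// gt_eqF//; lra.
  have t0 : 0 < t by rewrite /t divr_gt0//; lra.
  move: h1 hx hy; rewrite /h => h1 hx hy.
  have : t * ((1 / delta) `^ p - 1 - p * (1 - 1)) < 0 by rewrite pmulr_rlt0.
  have e : p * (t * (y - 1)) = p * (y - x) by rewrite tx.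
  move: le hx hy e; set A := (1 / delta) `^ p; set B := (y / delta) `^ p.
  set C := (x / delta) `^ p => le hx hy e.
  move: le; have -> : B = 1 + p * (y - 1) by lra.
  lra.
have cont : {within `[1, b], continuous h}.
  apply: derivable_within_continuous => x /[!in_itv]/= /andP[x1 _].
  apply: derivableB; last exact: ex_derive.
  apply: derivableB; last exact: ex_derive.
  have xd0 : 0 < x / delta by rewrite divr_gt0//; lra.
  pose g z : R := z / delta.
  have dg : derivable g x 1 by apply: derivableM.
  have df := is_derive1_powR p xd0.
  exact: (@ex_derive _ _ _ _ _ _ _
    (@is_derive1_comp _ (@powR R ^~ p) g x _ _ df (derivableP dg))).
have [x /[!in_itv]/= /andP[x1 xb] hx] : exists2 c, c \in `[1, b] & h c = 0.
  by apply: (IVT (ltW b1) cont); rewrite ge_min le_max (ltW h1) (ltW hb) orbT.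
have {}x1 : 1 < x.
  rewrite lt_neqAle x1 andbT; apply/eqP => e.
  by move: h1; rewrite e hx ltxx.
exists x; split=> [|y [y1 /rootE-/(_ y1) hy]].
  by split => //; exact/rootE.
case: (ltgtP x y) => // [xy|yx].
  by have := cvxh _ x1 hx _ xy; rewrite hy eqxx.
by have := cvxh _ y1 hy _ yx; rewrite hx eqxx.
Qed.

End Definitions.

(* Main.v *)
(* Write Q for the critical exponent, D = delta^p, s = 1/(q - 1), and let A be
   the mean of w on J.  For 0 < a <= A the rising sun lemma yields a disjoint
   union E_a of subintervals of J on each of which w has mean exactly a, with
   w >= a almost everywhere on J \ E_a.  On an interval of mean a the reverse
   Hoelder inequality says that the mean of crossing (w/a) is <= 0, where
   crossing y = y^p - p D y + (p - 1) D is <= 0 on [1, Q] and >= 0 on [Q, oo).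
   Integrating a^(-s-1) crossing (w/a) 1_(E_a) over eps < a < A, these signs
   show that, pointwise, the result is at least a multiple of max(w, eps)^(-s)
   minus an explicit affine function of w and w^p.  Averaging over J and letting
   eps tend to 0 gives <w^(-s)>_J <= (A Q)^(-s) / (1 - (Q - 1) s), which is (i);
   (ii) is the limit s -> 0, by Jensen's inequality.  Equality holds for
   w(t) = (t - l)^(Q - 1), l the left endpoint of I, and Hoelder's inequality
   puts this w in the class. *)

Require Import Defs.
From mathcomp Require Import all_boot all_order all_algebra.
From mathcomp Require Import all_classical all_reals all_analysis.
From mathcomp Require Import measurable_realfun ring lra.

Set Implicit Arguments.
Unset Strict Implicit.
Unset Printing Implicit Defensive.

Import Order.TTheory GRing.Theory Num.Theory.
Import numFieldNormedType.Exports.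

Local Open Scope classical_set_scope.
Local Open Scope ring_scope.

(** * The obstacle function *)

(** The tangent line behind [crossing] lies below the curve u2 = D u1^p and touches it only at u1 =
    1. The reverse Hoelder inequality therefore yields a nonpositive mean of [crossing] (w/a) only
    on intervals where w has mean exactly a; a mean merely comparable to a, as from a dyadic
    stopping time, would lose the constant. The sign argument fixes a value of w. Levels a > w count
    in full, because w >= a off E_a. For w/Q <= a <= w the integrand is nonpositive, so the
    indicator of E_a may be replaced by 1; for a < w/Q it is nonnegative and may be dropped. What
    remains is an integral over all levels above max(w/Q, eps), that is, a difference of two values
    of a primitive whose minimum is known. Nothing is lost for the power weight: there E_a is {w < Q
    a}, an interval starting at l, on which the reverse Hoelder inequality is an equality. The
    truncation by eps is there because w^(-s) is not known to be integrable beforehand. If (Q - 1) s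
    >= 1, the minimum of the primitive is no longer positive, in accordance with C_q = +oo for q <=
    Q. *)

Lemma powR_tangent (R : realType) (p y z : R) : 1 < p -> 0 <= y -> 0 < z ->
  z `^ p + p * z `^ (p - 1) * (y - z) <= y `^ p.
Proof.
move=> p1 y0 z0.
have p0 : 0 < p by lra.
have q0 : 0 < p / (p - 1) by rewrite divr_gt0 ?subr_gt0.
(* Young's inequality for the product of [y] and [z]^ (p - 1)[: the conjugate power of the second
   factor is]z [^ p], and multiplication by [p] leaves the tangent inequality. *)
have := @conjugate_powR R y (z `^ (p - 1)) p (p / (p - 1)) y0 (powR_ge0 _ _)
  p0 q0.
have -> : p^-1 + (p / (p - 1))^-1 = 1 by field; lra.
move=> /(_ erefl); rewrite -powRrM.
have -> : (p - 1) * (p / (p - 1)) = p by field; lra.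
have -> : z `^ p = z * z `^ (p - 1) by rewrite mulr_powRB1// ltW.
move: (y `^ p) (z `^ (p - 1)) => Y Z.
rewrite -(ler_pM2l p0).
have -> : p * (Y / p + z * Z / (p / (p - 1))) = Y + z * Z * (p - 1).
  by field; lra.
by lra.
Qed.


(* The range of (<w>_J, <w^p>_J) lies between the curves u2 = u1^p and
   u2 = D u1^p; the tangent to the latter at (1, D) meets the former at
   u1 = Q. *)
Definition tangent_data (R : realType) (p D Q : R) :=
  [/\ 1 < p, 1 <= D, 1 <= Q & Q `^ p = D * (p * Q - p + 1)].

Section gauge.
Context {R : realType}.
Implicit Types p D Q s y : R.

Definition crossing p D y := y `^ p - p * D * y + (p - 1) * D.

(** [crossing] is convex and vanishes at [Q], and its slope there is nonnegative: Q^p = D (p Q - p +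
    1) >= D Q because (p - 1) (Q - 1) >= 0, hence Q^(p - 1) >= D. *)
Lemma crossing_ge0 p D Q y : tangent_data p D Q -> Q <= y ->
  0 <= crossing p D y.
Proof.
move=> [p1 D1 Q1 QE] Qy; rewrite /crossing.
have Q0 : 0 < Q by lra.
have y0 : 0 <= y by lra.
have := powR_tangent p1 y0 Q0; rewrite QE => le.
suff : p * D * (y - Q) <= p * Q `^ (p - 1) * (y - Q) by lra.
apply: ler_wpM2r; first by rewrite subr_ge0.
apply: ler_wpM2l; first lra.
rewrite -(ler_pM2l Q0) mulr_powRB1; [|lra..].
rewrite QE mulrC; apply: ler_wpM2l; first lra.
have : 0 <= (p - 1) * (Q - 1) by rewrite mulr_ge0// subr_ge0// ltW.
by lra.
Qed.

(** By convexity it is enough to look at the ends, where [crossing] is 1 - D <= 0 and 0. Convexity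
    enters as the tangent at [y], evaluated at 1 and at [Q] and weighted by [Q - y] and [y - 1];
    both weights vanish when Q = 1, which is treated apart. *)
Lemma crossing_le0 p D Q y : tangent_data p D Q -> 1 <= y <= Q ->
  crossing p D y <= 0.
Proof.
move=> [p1 D1 Q1 QE] /andP[y1 yQ].
have y0 : 0 < y by lra.
have Q0 : 0 <= Q by lra.
have := powR_tangent p1 ler01 y0; rewrite powR1.
have := powR_tangent p1 Q0 y0; rewrite QE.
have [Q1'|Q1'] := ltP 1 Q; last first.
  move=> _ _; have yE : y = Q by lra.
  have Q1E : Q = 1 by lra.
  by rewrite /crossing yE QE Q1E; lra.
set Y := y `^ p; set Z := _ `^ _ => h1 h2.
rewrite -(pmulr_rle0 _ (_ : 0 < Q - 1)) ?subr_gt0// /crossing -/Y.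
have k1 : 0 <= (y - 1) * (D * (p * Q - p + 1) - (Y + p * Z * (Q - y))).
  by rewrite mulr_ge0//; lra.
have k2 : 0 <= (Q - y) * (1 - (Y + p * Z * (1 - y))) by rewrite mulr_ge0//; lra.
have k3 : 0 <= (Q - y) * (D - 1) by rewrite mulr_ge0//; lra.
lra.
Qed.

(** For s > 0, [y]^ s * gauge p D s y[is the integral of]u [^ (s - 1) * crossing p D u] over 0 < u <
    y, computed term by term. *)
Definition gauge p D s y :=
  y `^ p / (s + p) - p * D * y / (s + 1) + (p - 1) * D / s.

(* The minimum over [y >= 1] of [y `^ s * gauge p D s y], attained at [Q]. *)
Definition gauge_min p D Q s :=
  Q `^ s * D * (p * (p - 1) * (1 - (Q - 1) * s)) / (s * (s + 1) * (s + p)).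

Lemma gaugeQ p D Q s : tangent_data p D Q -> 0 < s ->
  Q `^ s * gauge p D s Q = gauge_min p D Q s.
Proof.
move=> [p1 D1 Q1 QE] s0; rewrite /gauge /gauge_min QE; field.
by rewrite !gt_eqF//; lra.
Qed.

Lemma is_derive_scaled_gauge p D s y : 1 < p -> 0 < s -> 0 < y ->
  is_derive y 1 (fun y => y `^ s * gauge p D s y)
    (y `^ (s - 1) * crossing p D y).
Proof.
move=> p1 s0 y0.
have d1 : is_derive y 1 (@powR R ^~ s) (s * y `^ (s - 1)).
  exact: is_derive1_powR.
have d2 : is_derive y 1 (@powR R ^~ p) (p * y `^ (p - 1)).
  exact: is_derive1_powR.
rewrite /gauge.
apply: is_derive_eq.
have -> : y `^ s = y * y `^ (s - 1) by rewrite mulr_powRB1// ltW.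
rewrite /crossing.
have -> : y `^ p = y * y `^ (p - 1) by rewrite mulr_powRB1//; lra.
rewrite /GRing.scale/=.
field.
by rewrite !gt_eqF//; lra.
Qed.

Lemma gauge_min_le p D Q s y : tangent_data p D Q -> 0 < s -> 0 <= y ->
  gauge_min p D Q s * (Num.max y 1) `^ (- s) <= gauge p D s y.
Proof.
move=> tD s0; have [p1 D1 Q1 QE] := tD.
pose f z := z `^ s * gauge p D s z.
have df z : 0 < z -> derivable f z 1.
  by move=> z0; apply: ex_derive; exact: is_derive_scaled_gauge.
have f'E z : 0 < z -> derive1 f z = z `^ (s - 1) * crossing p D z.
  move=> z0; rewrite derive1E.
  by have := is_derive_scaled_gauge D p1 s0 z0 => H; apply: derive_val.
have cf z1 z2 : 0 < z1 -> {within `[z1, z2], continuous f}.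
  move=> z10; apply: derivable_within_continuous => z.
  by rewrite in_itv/= => /andP[z1z _]; apply: df; lra.
have ge1 z : 1 <= z -> gauge_min p D Q s * z `^ (- s) <= gauge p D s z.
  move=> z1; have z0 : 0 < z by lra.
  have zs0 : 0 < z `^ s by rewrite powR_gt0.
  suff : f Q <= f z by rewrite powRN ler_pdivrMr// /f gaugeQ// [leRHS]mulrC.
  have [Qz|zQ] := leP Q z.
    apply: (@ger0_derive1_le_cc R f Q z); rewrite ?in_itv/= ?lexx ?Qz//.
    - by move=> u; rewrite in_itv/= => /andP[Qu _]; apply: df; lra.
    - move=> u; rewrite in_itv/= => /andP[Qu _]; rewrite f'E; last lra.
      by rewrite mulr_ge0 ?powR_ge0// (crossing_ge0 tD)// ltW.
    - by apply: cf; lra.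
  apply: (@ler0_derive1_le_cc _ f z Q); rewrite ?in_itv/= ?lexx ?(ltW zQ)//.
  - by move=> u; rewrite in_itv/= => /andP[Qu _]; apply: df; lra.
  - move=> u; rewrite in_itv/= => /andP[Qu uQ]; rewrite f'E; last lra.
    by rewrite mulr_ge0_le0 ?powR_ge0// (crossing_le0 tD)//; lra.
  - by apply: cf; lra.
(* Below 1 the left side is frozen at its value for y = 1, and [gauge] does not go under
   [gauge p D s 1]: its tangent at 1 has slope p (1 / (s + p) - D / (s + 1)) <= 0. *)
move=> y0; have [y1|y1] := leP y 1; last by apply: ge1; exact: ltW.
apply: le_trans (ge1 1 _) _ => //.
rewrite /gauge powR1.
have := powR_tangent p1 y0 (@ltr01 R); rewrite !powR1 => h.
have : 0 <= p * (1 - y) * (D / (s + 1) - 1 / (s + p)).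
  rewrite mulr_ge0//; first by rewrite mulr_ge0; lra.
  rewrite subr_ge0 ler_pdivrMr; last lra.
  rewrite mulrAC ler_pdivlMr; last lra.
  rewrite mul1r.
  have : 0 <= (D - 1) * (s + p) by rewrite mulr_ge0; lra.
  lra.
have : (1 + p * (y - 1)) / (s + p) <= y `^ p / (s + p).
  by rewrite ler_wpM2r ?invr_ge0; lra.
lra.
Qed.

End gauge.

Section potential.
Context {R : realType}.
Implicit Types p D Q s w a t : R.

Definition potential p D s w a := a `^ (- s) * gauge p D s (w / a).

Lemma potential_min_le p D Q s w a : tangent_data p D Q -> 0 < s -> 0 <= w ->
  0 < a -> gauge_min p D Q s * (Num.max w a) `^ (- s) <= potential p D s w a.
Proof.
move=> tD s0 w0 a0.
have wa0 : 0 <= w / a by rewrite divr_ge0// ltW.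
have := gauge_min_le tD s0 wa0.
have -> : Num.max w a = a * Num.max (w / a) 1.
  by rewrite maxr_pMr ?(ltW a0)// mulr1 mulrC divfK// gt_eqF.
rewrite powRM ?(ltW a0)//; last by rewrite le_max ler01 orbT.
rewrite /potential mulrCA ler_pM2l// powR_gt0//.
Qed.

Lemma expR_sub1_bounds (x t : R) : 0 < x ->
  t <= (expR (x * t) - 1) / x <= t * expR (x * t).
Proof.
move=> x0; apply/andP; split.
  by rewrite ler_pdivlMr// lerBrDl mulrC expR_ge1Dx.
rewrite ler_pdivrMr// -(ler_pM2r (expR_gt0 (- (x * t)))) mulrBl -!mulrA.
rewrite (mulrCA (expR _)) -expRD subrr expR0 mul1r mulr1.
have := expR_ge1Dx (- (x * t)); lra.
Qed.

(** One step of the mesh, of length [t] in the variable log a. The linear term is the increment to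
    be summed. For the remainder, (exp (x t) - 1) / x is bounded above in the two nonnegative terms
    and below, by [t], in the term with the minus sign. *)
Lemma potential_step p D s w a t : 1 < p -> 0 < D -> 0 < s -> 0 <= w ->
  0 < a -> 0 <= t ->
  potential p D s w (a * expR (- t)) - potential p D s w a <=
  t * (a `^ (- s) * crossing p D (w / a)) +
  t * (a `^ (- s) * ((expR ((s + p) * t) - 1) *
    ((w / a) `^ p + (p - 1) * D))).
Proof.
move=> p1 D0 s0 w0 a0 t0.
have y0 : 0 <= w / a by rewrite divr_ge0// ltW.
have yE : w / (a * expR (- t)) = w / a * expR t.
  by rewrite invfM -expRN opprK mulrA.
have E1 : (a * expR (- t)) `^ (- s) = a `^ (- s) * expR (s * t).
  by rewrite powRM ?(ltW a0) ?expR_ge0// -expRM mulrNN (mulrC t).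
rewrite /potential yE E1 /gauge /crossing powRM ?expR_ge0// -expRM.
set y := w / a in y0 *.
rewrite -mulrA -mulrBr !(mulrCA t) -mulrDr ler_wpM2l ?powR_ge0//.
have sp0 : 0 < s + p by lra.
have s_sp : s <= s + p by lra.
have s10 : 0 < s + 1 by lra.
have [/andP[l1 u1]] := (expR_sub1_bounds t sp0).
have [/andP[l2 u2]] := (expR_sub1_bounds t s10).
have [/andP[l3 u3]] := (expR_sub1_bounds t s0).
have m1 : expR (s * t) <= expR ((s + p) * t).
  by rewrite ler_expR ler_wpM2r.
have e1 : expR (s * t) * expR (p * t) = expR ((s + p) * t).
  by rewrite -expRD mulrDl.
have e2 : expR (s * t) * expR t = expR ((s + 1) * t).
  by rewrite -expRD mulrDl mul1r.
have Y0 : 0 <= y `^ p by rewrite powR_ge0.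
move: (y `^ p) Y0 => Y Y0.
have k1 := ler_wpM2l Y0 u1.
have p0 : 0 <= p by lra.
have pDy0 : 0 <= p * D * y by rewrite (mulr_ge0 _ y0)// mulr_ge0// ltW.
have k2 := ler_wpM2l pDy0 l2.
have pD0 : 0 <= (p - 1) * D by rewrite mulr_ge0 ?(ltW D0)// subr_ge0 ltW.
have k3 := ler_wpM2l pD0 u3.
have k4 : (p - 1) * D * (t * expR (s * t)) <=
    (p - 1) * D * (t * expR ((s + p) * t)) by rewrite ler_wpM2l// ler_wpM2l.
have -> : expR (s * t) * (Y * expR (t * p) / (s + p) -
    p * D * (y * expR t) / (s + 1) + (p - 1) * D / s) -
    (Y / (s + p) - p * D * y / (s + 1) + (p - 1) * D / s) =
   Y * ((expR ((s + p) * t) - 1) / (s + p)) -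
   p * D * y * ((expR ((s + 1) * t) - 1) / (s + 1)) +
   (p - 1) * D * ((expR (s * t) - 1) / s).
  rewrite -e1 -e2 (mulrC t p); lra.
lra.
Qed.

(* A Riemann sum over a geometric mesh replaces the integral over a: the sets
   E_a then need no joint measurability, and [e i] records membership in
   E_(a i).  [K] absorbs the discretisation error. *)
Lemma potential_mesh p D Q s w A t K n (e : nat -> bool) :
  let a i := A * expR (- (i%:R * t)) in
  tangent_data p D Q -> 0 < s -> 0 <= w -> 0 < A -> 0 <= t -> 0 <= K ->
  (forall i, (i < n)%N -> ~~ e i -> a i <= w) ->
  (forall i, (i < n)%N -> a i `^ (- s) * ((expR ((s + p) * t) - 1) *
    ((w / a i) `^ p + (p - 1) * D)) <= K) ->
  gauge_min p D Q s * (Num.max w (a n)) `^ (- s) <=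
  potential p D s w A +
  \sum_(i < n) t * (a i `^ (- s) * crossing p D (w / a i)) *+ e i +
  n%:R * t * K.
Proof.
move=> a tD s0 w0 A0 t0 K0 ew Kge.
have [p1 D1 Q1 _] := tD.
have a0 i : 0 < a i by rewrite mulr_gt0// expR_gt0.
have aS i : a i.+1 = a i * expR (- t).
  by rewrite /a -mulrA -expRD -opprD -natr1 mulrDl mul1r.
pose S m := potential p D s w A +
  \sum_(i < m) t * (a i `^ (- s) * crossing p D (w / a i)) *+ e i +
  m%:R * t * K.
rewrite -/(S n).
have SS m : S m.+1 = S m +
    t * (a m `^ (- s) * crossing p D (w / a m)) *+ e m + t * K.
  by rewrite /S big_ord_recr/= -natr1; lra.
have tK0 : 0 <= t * K by rewrite mulr_ge0.
(* As long as every term may be bounded by its value with [e i] true, [S m]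
   dominates the potential; otherwise [a m <= w / Q] and all later terms are
   nonnegative. *)
suff : forall m, (m <= n)%N -> potential p D s w (a m) <= S m \/
    Q * a m <= w /\ gauge_min p D Q s * w `^ (- s) <= S m.
  move=> /(_ n (leqnn _))[|[Qw]].
    by apply: le_trans; exact: potential_min_le.
  have /max_idPl -> // : a n <= w.
  by apply: le_trans Qw; rewrite ler_peMl // ltW.
elim=> [_|m IH mn].
  left; rewrite /S big_ord0 addr0 !mul0r addr0 /a mul0r oppr0 expR0 mulr1.
  exact: lexx.
have {IH} [IH|[Qw IH]] := IH (ltnW mn).
  have [em|em] := boolP (e m || (crossing p D (w / a m) <= 0)).
    left; have D0 : 0 < D by lra.
    have := potential_step p1 D0 s0 w0 (a0 m) t0; rewrite -aS SS.
    have := ler_wpM2l t0 (Kge _ mn).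
    have : t * (a m `^ (- s) * crossing p D (w / a m)) <=
           t * (a m `^ (- s) * crossing p D (w / a m)) *+ e m.
      case: (e m) em => //= em; rewrite mulr0n.
      by rewrite mulr_ge0_le0// mulr_ge0_le0// powR_ge0.
    lra.
  right; move: em; rewrite negb_or -ltNge => /andP[em cr].
  have amw := ew _ mn em.
  have Qw : Q * a m <= w.
    rewrite -ler_pdivlMr// leNgt; apply/negP => wQ.
    have : crossing p D (w / a m) <= 0.
      by rewrite (crossing_le0 tD)// (ltW wQ) andbT ler_pdivlMr// mul1r.
    lra.
  split.
    apply: le_trans Qw; rewrite ler_wpM2l//; first lra.
    by rewrite aS ger_pMr// -expR0 ler_expR oppr_le0.
  rewrite SS (negbTE em) mulr0n addr0; apply: ler_wpDr => //.
  apply: le_trans IH; have := potential_min_le tD s0 w0 (a0 m).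
  by rewrite (max_idPl amw).
right; split.
  apply: le_trans Qw; rewrite ler_wpM2l//; first lra.
  by rewrite aS ger_pMr// -expR0 ler_expR oppr_le0.
rewrite SS -addrA; apply: ler_wpDr => //; apply: addr_ge0 => //.
rewrite mulrn_wge0// mulr_ge0// mulr_ge0 ?powR_ge0//.
by rewrite (crossing_ge0 tD)// ler_pdivlMr.
Qed.

End potential.

(** * Rising sun sets *)

(** The set collects the points lying below some earlier value of [G]. Endpoints of a component are
    outside it, so [G c] dominates everything before [c], and [G d >= G c]; for a component that
    reaches [T] the latter comes from the maximality of [G T]. *)
Lemma rising_sun (R : realType) (G : R -> R) (l T : R) :
  {within `[l, T], continuous G} -> (forall x, x \in `[l, T] -> G x <= G T) ->
  exists J : nat -> set R,
    [/\ trivIset setT J,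
        \bigcup_n J n =
          [set x | (x \in `]l, T[) /\
            exists y, (y \in `[l, x[) /\ G x < G y] &
        forall n, J n = set0 \/ exists c d,
          [/\ J n = `]c, d[%classic, l <= c, c < d, d <= T & G c = G d]].
Proof.
move=> cG GT; set O := [set x | _ /\ _].
have oG x : x \in `]l, T[ -> {for x, continuous G}.
  have : {within `]l, T[, continuous G}.
    by apply: continuous_subspaceW cG; exact: subset_itv_oo_cc.
  by rewrite continuous_open_subspace// => + xlT; apply; rewrite inE.
have oO : open O.
  rewrite openE => x [xlT [y [+ Gxy]]].
  rewrite in_itv/= => /andP[ly yx].
  rewrite /interior; near=> z.
  have zlT : z \in `]l, T[.
    by near: z; exact: near_in_itvoo.
  split => //; exists y; split; last first.
    by near: z; apply: (cvgr_lt (G x) (oG _ xlT)).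
  rewrite in_itv/= ly/=.
  by near: z; exact: (lt_nbhsr yx).
exists (open_disjoint_itv oO); split.
- exact: open_disjoint_itv_trivIset.
- by rewrite -open_disjoint_itv_bigcup.
move=> n; set J := open_disjoint_itv oO n.
have oJ : open J by exact: open_disjoint_itv_open.
have JO : J `<=` O.
  by rewrite [X in _ `<=` X](open_disjoint_itv_bigcup oO); apply: bigcup_sup.
have [->|/set0P[x0 Jx0]] := eqVneq J set0; first by left.
have Jl x : J x -> l < x < T by move=> /JO[]; rewrite in_itv.
have lbJ : has_lbound J by exists l => x /Jl /andP[/ltW].
have ubJ : has_ubound J by exists T => x /Jl /andP[_ /ltW].
have JE : J = `]inf J, sup J[%classic.
  rewrite set_itvE -interval_bounded_interior//; last exact: open_disjoint_itv_is_interval.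
  by apply/seteqP; split; [rewrite -open_subsetE|exact: interior_subset].
set c := inf J in JE; set d := sup J in JE.
have cx0d : c < x0 < d by move: Jx0; rewrite JE/= in_itv.
have cd : c < d by lra.
have lc : l <= c.
  by apply: lb_le_inf; [exists x0|move=> x /Jl /andP[/ltW]].
have dT : d <= T.
  by apply: ge_sup; [exists x0|move=> x /Jl /andP[_ /ltW]].
(* An endpoint of a component cannot lie in the open set, since the component
   containing it would overlap. *)
have endO e : ~ J e -> (forall u, 0 < u -> exists2 z, J z & `|e - z| < u) ->
    ~ O e.
  move=> nJe clJ Oe.
  have [m _ Jme] : (\bigcup_m open_disjoint_itv oO m) e.
    by rewrite -open_disjoint_itv_bigcup.
  have /nbhs_ballP[u /= u0 bJm] : nbhs e (open_disjoint_itv oO m).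
    by apply: open_nbhs_nbhs; split => //; exact: open_disjoint_itv_open.
  have [z Jz ez] := clJ _ u0.
  have mn : m = n.
    have /(_ m n I I) := @open_disjoint_itv_trivIset _ _ oO; apply.
    by exists z; split => //; apply: bJm.
  by move: Jme; rewrite mn.
have Oc : ~ O c.
  apply: endO; first by rewrite JE/= in_itv/= ltxx.
  move=> u u0; exists (Num.min x0 (c + u / 2)).
    rewrite JE/= in_itv/= lt_min gt_min; apply/andP; split; last first.
      by apply/orP; left; lra.
    by apply/andP; split; lra.
  have : c < Num.min x0 (c + u / 2) by rewrite lt_min; apply/andP; split; lra.
  have : Num.min x0 (c + u / 2) <= c + u / 2 by rewrite ge_min lexx orbT.
  move: (Num.min _ _) => z h1 h2; rewrite ltr_norml; apply/andP; split; lra.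
have Od : ~ O d.
  apply: endO; first by rewrite JE/= in_itv/= ltxx andbF.
  move=> u u0; exists (Num.max x0 (d - u / 2)).
    rewrite JE/= in_itv/= gt_max lt_max; apply/andP; split.
      by apply/orP; left; lra.
    by apply/andP; split; lra.
  have : Num.max x0 (d - u / 2) < d by rewrite gt_max; apply/andP; split; lra.
  have : d - u / 2 <= Num.max x0 (d - u / 2) by rewrite le_max lexx orbT.
  move: (Num.max _ _) => z h1 h2; rewrite ltr_norml; apply/andP; split; lra.
have Gc y : l <= y <= c -> G y <= G c.
  move=> /andP[ly]; rewrite le_eqVlt => /predU1P[->//|yc].
  rewrite leNgt; apply/negP => Gyc; apply: Oc; split.
    by rewrite in_itv/=; apply/andP; split; lra.
  by exists y; rewrite in_itv/= ly.
have Gd : G c <= G d.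
  have [dT'|Td] := ltP d T; last first.
    have -> : d = T by lra.
    by apply: GT; rewrite in_itv/=; apply/andP; split; lra.
  rewrite leNgt; apply/negP => Gyc; apply: Od; split.
    by rewrite in_itv/=; apply/andP; split; lra.
  by exists c; rewrite in_itv/= lc.
(* A maximum of [G] over [[c, x]] can only sit at [c]: elsewhere it would be a point of the set,
   with a larger value before it, and neither [[c, x]] nor the part before [c] offers one. *)
have Gin x : c < x < d -> G x <= G c.
  move=> /andP[cx xd].
  have cGx : {within `[c, x], continuous G}.
    apply: continuous_subspaceW cG; apply: subset_itvScc.
      by rewrite bnd_simp.
    by rewrite bnd_simp (le_trans _ dT)// ltW.
  have [z zcx zmax] := EVT_max (ltW cx) cGx.
  have xcx : x \in `[c, x] by rewrite in_itv/= lexx ltW.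
  apply: le_trans (zmax _ xcx) _; move: zcx; rewrite in_itv/= => /andP[].
  rewrite le_eqVlt => /predU1P[<-//|cz] zx.
  have /JO[_ [y []]] : J z.
    by rewrite JE/= in_itv/= cz (le_lt_trans zx xd).
  rewrite in_itv/= => /andP[ly yz] Gzy.
  have [yc|cy] := leP y c.
    have := Gc y; rewrite ly yc => /(_ isT).
    have := zmax c; rewrite in_itv/= lexx (ltW cx) => /(_ isT).
    lra.
  have := zmax y; rewrite in_itv/= (ltW cy) (le_trans (ltW yz) zx) => /(_ isT).
  lra.
right; exists c, d; split => //.
apply/eqP; rewrite eq_le Gd/= leNgt; apply/negP => Gcd.
have cGd : {within `[c, d], continuous G}.
  by apply: continuous_subspaceW cG; exact: subset_itvScc.
(* If [G c < G d], the midpoint value is attained inside the component, where [Gin] keeps [G] below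
   [G c]. *)
have := IVT (v := (G c + G d) / 2) (ltW cd) cGd.
case.
  by rewrite ge_min le_max; apply/andP; split; apply/orP; [left|right]; lra.
move=> x; rewrite in_itv/= => /andP[].
rewrite le_eqVlt => /predU1P[<- _ h|cx]; first by move: Gcd h; clear; lra.
rewrite le_eqVlt => /predU1P[-> h|xd h]; first by move: Gcd h; clear; lra.
by have := Gin x; rewrite cx xd => /(_ isT); move: Gcd h; clear; lra.
Unshelve. all: by end_near. Qed.

(** Provides the maximality that [rising_sun] asks for at its right end: [T] is the first point
    where [G] reaches the level [G r]. The interval left over, from [T] to [r], has equal values of
    [G] at its ends and so is itself an interval of the required mean. *)
Lemma first_hit (R : realType) (G : R -> R) (l r : R) : l <= r ->
  (forall x, x \in `[l, r] -> {for x, continuous G}) -> G l <= G r ->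
  exists T, [/\ T \in `[l, r], G T = G r &
    forall x, x \in `[l, T] -> G x <= G T].
Proof.
move=> lr cG Glr.
pose S := [set x | (x \in `[l, r]) /\ G r <= G x].
have Sr : S r by split; rewrite ?in_itv/= ?lexx ?lr.
have lbS : has_lbound S by exists l => x [+ _]; rewrite in_itv/= => /andP[].
pose T := inf S.
have lT : l <= T.
  by apply: lb_le_inf; [exists r|move=> x [+ _]; rewrite in_itv/= => /andP[]].
have Tr : T <= r by apply: ge_inf.
have Tlr : T \in `[l, r] by rewrite in_itv/= lT.
have GT : G r <= G T.
  rewrite leNgt; apply/negP => GTr.
  have /nbhs_ballP[e /= e0 be] : \forall z \near T, G z < G r.
    exact: (cvgr_lt (G T) (cG _ Tlr)).
  have [|z [zlr Gz] zT] := @inf_adherent R S e e0; first by split; [exists r|].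
  suff /be : ball T e z by rewrite /= ltNge Gz.
  rewrite /ball/= ltr_norml.
  have Tz : T <= z by apply: ge_inf => //; split.
  by move: zT; rewrite -/T => zT; apply/andP; split; lra.
have wG : {within `[l, T], continuous G}.
  apply: continuous_in_subspaceT => x; rewrite inE/= in_itv/= => /andP[lx xT].
  by apply: cG; rewrite in_itv/= lx (le_trans xT).
have GTE : G T = G r.
  have [|c] := IVT (v := G r) lT wG; first by rewrite ge_min Glr le_max GT orbT.
  rewrite in_itv/= => /andP[lc cT] Gc.
  suff -> : T = c by [].
  apply/eqP; rewrite eq_le cT andbT; apply: ge_inf => //; split.
    by rewrite in_itv/= lc (le_trans cT).
  by rewrite Gc.
exists T; split => // x; rewrite in_itv/= => /andP[lx].
rewrite le_eqVlt => /predU1P[->//|xT].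
rewrite leNgt; apply/negP; rewrite GTE => /ltW Gx.
suff : T <= x by rewrite leNgt xT.
apply: ge_inf => //; split => //.
by rewrite in_itv/= lx (le_trans (ltW xT)).
Qed.

(** Outside the rising sun set only the difference quotients to the left are controlled, so the
    derivative is computed as a limit from the left. *)
Lemma derive1_ge_left (R : realType) (F : R -> R) (l x a : R) : l < x ->
  derivable F x 1 -> (forall y, l <= y < x -> a * (x - y) <= F x - F y) ->
  a <= derive1 F x.
Proof.
move=> lx dF Fa.
have := @cvg_at_leftE R R _ 0 dF.
rewrite derive1E /derive => ->.
apply: limr_ge; first by apply: cvgP; apply: cvg_dnbhs_at_left; exact: dF.
near=> h.
have h0 : h < 0 by near: h; exact: nbhs_left_lt.
have hlx : l - x < h by near: h; apply: nbhs_left_gt; lra.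
rewrite /= /GRing.scale/= mulr1 mulrC ler_ndivlMr//.
have := Fa (h + x); rewrite (_ : l <= h + x < x); last by apply/andP; split; lra.
move=> /(_ isT); lra.
Unshelve. all: by end_near. Qed.

Section low_average_set.
Context {R : realType}.
Local Notation mu := (@lebesgue_measure R).

(** With G(x) = F(x) - a x and F a primitive of f, an interval has mean [a] exactly when [G] agrees
    at its ends; the components and the interval from [T] to [r] are such intervals. At any other
    point except [T] all left difference quotients of [F] are at least [a], whence f >= a almost
    everywhere by Lebesgue differentiation. *)
Lemma low_average_set (f : R -> R) (l r a : R) :
  mu.-integrable setT (EFin \o f) -> l < r ->
  a * (r - l) <= \int[mu]_(t in `]l, r[) f t ->
  exists E : set (measurableTypeR R), [/\ measurable E, E `<=` `]l, r[,
    {ae mu, forall x, `]l, r[%classic x -> ~ E x -> a <= f x} &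
    forall g : R -> R, mu.-integrable `]l, r[ (EFin \o g) ->
      (forall x y, l <= x -> x < y -> y <= r ->
        \int[mu]_(t in `]x, y[) f t = a * (y - x) ->
        (\int[mu]_(t in `]x, y[) (g t)%:E <= 0)%E) ->
      (\int[mu]_(t in E) (g t)%:E <= 0)%E].
Proof.
move=> fi lr fa.
have fiS (A : set R) : measurable A -> mu.-integrable A (EFin \o f).
  by move=> mA; apply: integrableS fi.
(* Starting the primitive at [l - 1] makes it continuous on both sides of [l]. *)
pose F x := \int[mu]_(t in `[l - 1, x]) f t.
have FB x y : l - 1 <= x -> x <= y -> F y - F x = \int[mu]_(t in `]x, y[) f t.
  move=> lx xy; rewrite /F Rintegral_itvB ?bnd_simp//; last exact: fiS.
  by rewrite -Rintegral_itv_bndo_bndc//; exact: fiS.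
have cF x : x \in `[l, r] -> {for x, continuous F}.
  rewrite in_itv/= => /andP[lx xr].
  have : {within `]l - 1, r + 1[, continuous F}.
    apply: (@continuous_subspaceW _ _ _ `[l - 1, r + 1]).
      exact: subset_itv_oo_cc.
    by apply: parameterized_integral_continuous; [lra|exact: fiS].
  rewrite continuous_open_subspace// => /(_ x); apply.
  by rewrite inE/= in_itv/=; apply/andP; split; lra.
pose G x := F x - a * x.
have cG x : x \in `[l, r] -> {for x, continuous G}.
  move=> xlr; apply: continuousB; first exact: cF.
  by apply: continuousM; [exact: cvg_cst|exact: cvg_id].
have Glr : G l <= G r.
  have : F r - F l = \int[mu]_(t in `]l, r[) f t by apply: FB; lra.
  by rewrite /G; move: fa; lra.
have [T [Tlr GT GleT]] := first_hit (ltW lr) cG Glr.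
have [lT Tr] : l <= T /\ T <= r by move: Tlr; rewrite in_itv/= => /andP[].
have wG : {within `[l, T], continuous G}.
  apply: continuous_in_subspaceT => x; rewrite inE/= in_itv/= => /andP[lx xT].
  by apply: cG; rewrite in_itv/= lx (le_trans xT).
have [J [tJ UJ JE]] := rising_sun wG GleT.
have mJ n : measurable (J n).
  have [->|[c [d [-> _ _ _ _]]]] := JE n; first exact: measurable0.
  exact: measurable_itv.
have JlT n : J n `<=` `]l, T[.
  by move=> x Jx; have : (\bigcup_n J n) x by [exists n]; rewrite UJ => -[].
have JlTU : \bigcup_n J n `<=` `]l, T[ by apply: bigcup_sub.
have mU : measurable (\bigcup_n J n) by exact: bigcupT_measurable.
have Elr : \bigcup_n J n `|` `]T, r[ `<=` `]l, r[.
  move=> x [/JlTU|] /=; rewrite !in_itv/= => /andP[h1 h2].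
    by rewrite h1 (lt_le_trans h2).
  by rewrite h2 (le_lt_trans lT).
have avgE x y : l <= x -> x < y -> y <= r -> G x = G y ->
    \int[mu]_(t in `]x, y[) f t = a * (y - x).
  move=> lx xy yr; rewrite -FB; [|lra|lra].
  by rewrite /G; lra.
exists (\bigcup_n J n `|` `]T, r[); split => //.
- by apply: measurableU => //; exact: measurable_itv.
- have locf : locally_integrable [set: R] f.
    by apply: open_integrable_locally => //; exact: openT.
  have := @FTC1 R f (BLeft (l - 1)) (fun y => fiS _ (measurable_itv _)) locf.
  have : mu.-negligible [set T].
    by exists [set T]; split => //; exact: lebesgue_measure_set1.
  move=> nT; have aeT : {ae mu, forall x, x <> T}.
    by apply: negligibleS nT => x /= /contrapT ->.
  apply: filterS2 aeT; first exact: (ae_filter_ringOfSetsType mu).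
  move=> x xT dF; rewrite /= in_itv/= => /andP[lx xr] nE.
  have lx1 : l - 1 < x by lra.
  have [dFx <-] := dF lx1.
  have {}xT : x < T.
    rewrite lt_neqAle; apply/andP; split; first exact/eqP.
    rewrite leNgt; apply/negP => Tx; apply: nE; right.
    by rewrite /= in_itv/= Tx.
  apply: (derive1_ge_left lx dFx) => y /andP[ly yx].
  suff Gyx : G y <= G x.
    by change (a * (x - y) <= F x - F y); move: Gyx; rewrite /G; lra.
  rewrite leNgt; apply/negP => Gxy; apply: nE; left.
  rewrite UJ /=; split; first by rewrite in_itv/= lx.
  by exists y; rewrite in_itv/= ly.
- move=> g gi gle.
  have giS (A : set R) : measurable A -> A `<=` `]l, r[ ->
      mu.-integrable A (EFin \o g).
    by move=> mA Alr; apply: integrableS gi.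
  have mg := measurable_int mu gi.
  rewrite integral_setU//; last 2 first.
  - by apply: measurable_funS mg.
  - apply/disj_setPS => x [/JlTU/=].
    rewrite !in_itv/= => /andP[_ xT] /andP[Tx _].
    by have := lt_trans xT Tx; rewrite ltxx.
  apply: adde_le0.
  + rewrite integral_bigcup//; last first.
      by apply: giS => //; apply: subset_trans Elr; exact: subsetUl.
    apply: npeseries_le0 => n _ _.
    have [->|[c [d [-> lc cd dT Gcd]]]] := JE n; first by rewrite integral_set0.
    have dr : d <= r by lra.
    by apply: gle => //; exact: avgE.
  + move: Tr; rewrite le_eqVlt => /predU1P[->|Tr].
      by rewrite set_itvoo0 ?integral_set0.
    by apply: gle => //; exact: avgE.
Qed.

End low_average_set.

(** * Bound on the negative moment *)

Lemma integrable_EFinM d (T : measurableType d) (R : realType)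
    (mu : {measure set T -> \bar R}) (D : set T) (k : R) (u : T -> R) :
  measurable D -> mu.-integrable D (EFin \o u) ->
  mu.-integrable D (EFin \o (fun t => k * u t)).
Proof.
move=> mD ui.
have -> : EFin \o (fun t => k * u t) = (fun t => k%:E * (EFin \o u) t)%E by [].
exact: integrableZl.
Qed.

Lemma integrable_EFinD d (T : measurableType d) (R : realType)
    (mu : {measure set T -> \bar R}) (D : set T) (u v : T -> R) :
  measurable D -> mu.-integrable D (EFin \o u) ->
  mu.-integrable D (EFin \o v) ->
  mu.-integrable D (EFin \o (fun t => u t + v t)).
Proof.
move=> mD ui vi.
have -> : EFin \o (fun t => u t + v t) = ((EFin \o u) \+ (EFin \o v))%E by [].
exact: integrableD.
Qed.

Section affine_combination.
Context {R : realType}.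
Local Notation mu := (@lebesgue_measure R).

Lemma integrable_cst_oo (x y c : R) : mu.-integrable `]x, y[ (EFin \o cst c).
Proof.
apply: measurable_bounded_integrable => //.
- by rewrite /= lebesgue_measure_itv/=; case: ifP => _; rewrite ?ltry.
- exists `|c|; split; first by rewrite num_real.
  by move=> M cM z _ /=; exact: ltW.
Qed.

Lemma integrable_affine (u v : R -> R) (x y c1 c2 c3 : R) :
  mu.-integrable `]x, y[ (EFin \o u) -> mu.-integrable `]x, y[ (EFin \o v) ->
  mu.-integrable `]x, y[ (EFin \o (fun t => c1 * u t + c2 * v t + c3)).
Proof.
move=> ui vi.
have mI := measurable_itv `]x, y[.
apply: integrable_EFinD => //; last exact: integrable_cst_oo.
by apply: integrable_EFinD => //; exact: integrable_EFinM.
Qed.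

Lemma Rintegral_affine (u v : R -> R) (x y c1 c2 c3 : R) : x <= y ->
  mu.-integrable `]x, y[ (EFin \o u) -> mu.-integrable `]x, y[ (EFin \o v) ->
  \int[mu]_(t in `]x, y[) (c1 * u t + c2 * v t + c3) =
  c1 * \int[mu]_(t in `]x, y[) u t + c2 * \int[mu]_(t in `]x, y[) v t +
  c3 * (y - x).
Proof.
move=> xy ui vi.
have mI := measurable_itv `]x, y[.
have u'i : mu.-integrable `]x, y[ (EFin \o (fun t => c1 * u t)).
  exact: integrable_EFinM.
have v'i : mu.-integrable `]x, y[ (EFin \o (fun t => c2 * v t)).
  exact: integrable_EFinM.
rewrite RintegralD//; last 2 first.
- exact: integrable_EFinD.
- exact: integrable_cst_oo.
rewrite RintegralD// !RintegralZl// Rintegral_cst//.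
rewrite /= lebesgue_measure_itv/= lte_fin.
case: ltP => [_|yx]; first by rewrite -EFinD.
have -> : y = x by apply/eqP; rewrite eq_le xy yx.
by rewrite subrr.
Qed.

Lemma Rintegral_ae_ge0 (D : set (measurableTypeR R)) (h : R -> R) : measurable D ->
  mu.-integrable D (EFin \o h) -> {ae mu, forall t, D t -> 0 <= h t} ->
  0 <= \int[mu]_(t in D) h t.
Proof.
move=> mD hi h0; have mh := measurable_int mu hi.
suff -> : \int[mu]_(t in D) h t = \int[mu]_(t in D) `|h t|.
  by apply: Rintegral_ge0 => t _.
congr fine; apply: ae_eq_integral => //.
  by apply/measurable_EFinP; apply: measurableT_comp => //; exact/measurable_EFinP.
apply: filterS h0.
by move=> t ht Dt /=; rewrite ger0_norm// ht.
Qed.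

Lemma ae_forall_nat (P : nat -> R -> Prop) :
  (forall i, {ae mu, forall t, P i t}) -> {ae mu, forall t i, P i t}.
Proof.
move=> aeP; have := negligible_bigcup aeP.
apply: negligibleS => t /= /existsNP[i nP]; exists i => //.
Qed.

End affine_combination.

Section sum_restricted.
Context {R : realType}.
Local Notation mu := (@lebesgue_measure R).

(** The factor [*+ (t \in E i)] plays the indicator of [E i], in the shape that [potential_mesh]
    produces. *)
Lemma Rintegral_sum_restrict_le0 (l r : R) (n : nat) (c : nat -> R)
    (g : nat -> R -> R) (E : nat -> set (measurableTypeR R)) :
  (forall i, 0 <= c i) -> (forall i, measurable (E i)) ->
  (forall i, E i `<=` `]l, r[) ->
  (forall i, mu.-integrable `]l, r[ (EFin \o g i)) ->
  (forall i, (\int[mu]_(t in E i) (g i t)%:E <= 0)%E) ->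
  let S t := \sum_(i < n) (c i * g i t) *+ (t \in E i) in
  mu.-integrable `]l, r[ (EFin \o S) /\ \int[mu]_(t in `]l, r[) S t <= 0.
Proof.
move=> c0 mE Elr gi gE; elim: n => [|n [IHi IH]] /=.
  have -> : (fun t => \sum_(i < 0) (c i * g i t) *+ (t \in E i)) = cst 0.
    by apply/funext => t; rewrite big_ord0.
  split; first exact: integrable_cst_oo.
  by rewrite Rintegral_cst// mul0r.
pose h t := (fun t => c n * g n t) \_ (E n) t.
have hE t : (c n * g n t) *+ (t \in E n) = h t.
  by rewrite /h patchE; case: (t \in E n); rewrite ?mulr1n ?mulr0n.
have mI := measurable_itv `]l, r[.
have cgi : mu.-integrable `]l, r[ (EFin \o (fun t => c n * g n t)).
  exact: integrable_EFinM.
have gEi : mu.-integrable (E n) (EFin \o g n).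
  by apply: integrableS (gi n).
have hi : mu.-integrable `]l, r[ (EFin \o h).
  rewrite /h -restrict_EFin; apply/integrable_restrict => //.
  by apply: integrableS cgi => //; exact: measurableI.
have -> : (fun t => \sum_(i < n.+1) (c i * g i t) *+ (t \in E i)) =
    (fun t => \sum_(i < n) (c i * g i t) *+ (t \in E i) + h t).
  by apply/funext => t; rewrite big_ord_recr/= hE.
split; first exact: integrable_EFinD.
rewrite RintegralD//; apply: ler_wnDl IH _.
rewrite /h -Rintegral_mkcondr setIidr// RintegralZl//.
rewrite mulr_ge0_le0// fine_le0//.
Qed.

End sum_restricted.

Section truncated_moment.
Context {R : realType}.
Local Notation mu := (@lebesgue_measure R).
Implicit Types (p D Q s a b x y l r A T : R) (w : R -> R).

Lemma powR_div a b p : 0 <= a -> 0 < b -> (a / b) `^ p = b `^ (- p) * a `^ p.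
Proof.
move=> a0 b0; rewrite powRM ?invr_ge0 ?(ltW b0)// mulrC; congr (_ * _).
by rewrite -powR_inv1 ?ltW// -powRrM mulN1r.
Qed.

Lemma crossing_affine p D a b : 0 <= a -> 0 < b ->
  crossing p D (a / b) =
  b `^ (- p) * a `^ p + (- (p * D / b)) * a + (p - 1) * D.
Proof. by move=> a0 b0; rewrite /crossing powR_div//; lra. Qed.

Lemma gauge_affine p D s a b : 0 <= a -> 0 < b ->
  gauge p D s (a / b) =
  (b `^ (- p) / (s + p)) * a `^ p + (- (p * D / (b * (s + 1)))) * a +
  (p - 1) * D / s.
Proof.
by move=> a0 b0; rewrite /gauge powR_div// [in RHS]invfM; lra.
Qed.

(** The reverse Hoelder condition raised to the power [p], with D = delta^p, and cleared of its
    denominator; on open intervals with finite integrals it is a statement about real numbers. *)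
Definition reverse_holder_Rintegral p D l r w :=
  forall x y, l <= x -> x < y -> y <= r ->
  \int[mu]_(t in `]x, y[) (w t `^ p) <=
  D * (y - x) * ((\int[mu]_(t in `]x, y[) w t) / (y - x)) `^ p.

Lemma reverse_holder_low_set p D Q w l r A a :
  tangent_data p D Q -> l < r -> 0 < a -> a <= A -> (forall t, 0 <= w t) ->
  mu.-integrable setT (EFin \o w) ->
  mu.-integrable setT (EFin \o (fun t => w t `^ p)) ->
  \int[mu]_(t in `]l, r[) w t = A * (r - l) ->
  reverse_holder_Rintegral p D l r w ->
  exists E : set (measurableTypeR R), [/\ measurable E, E `<=` `]l, r[,
    {ae mu, forall t, `]l, r[%classic t -> ~ E t -> a <= w t} &
    (\int[mu]_(t in E) (crossing p D (w t / a))%:E <= 0)%E].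
Proof.
move=> [p1 D1 Q1 QE] lr a0 aA w0 wi wpi wA RH.
have iS (u : R -> R) (x y : R) : mu.-integrable setT (EFin \o u) ->
    mu.-integrable `]x, y[ (EFin \o u).
  by move=> ui; apply: integrableS ui.
have aw : a * (r - l) <= \int[mu]_(t in `]l, r[) w t.
  by rewrite wA ler_wpM2r// subr_ge0 ltW.
have [E [mE Elr aeE gE]] := low_average_set wi lr aw.
have gi x y : mu.-integrable `]x, y[ (EFin \o fun t => crossing p D (w t / a)).
  have -> : (fun t => crossing p D (w t / a)) = (fun t =>
      a `^ (- p) * w t `^ p + (- (p * D / a)) * w t + (p - 1) * D).
    by apply/funext => t; rewrite crossing_affine.
  by apply: integrable_affine; exact: iS.
exists E; split => //; apply: gE => [|x y lx xy yr avg]; first exact: gi.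
rewrite -(@fineK _ (\int[mu]_(t in _) _)%E); last exact: integrable_fin_num (gi x y).
rewrite lee_fin -/(Rintegral mu _ _).
rewrite (@eq_Rintegral _ _ _ mu _ (fun t =>
  a `^ (- p) * w t `^ p + (- (p * D / a)) * w t + (p - 1) * D)); last first.
  by move=> t _; rewrite crossing_affine.
rewrite Rintegral_affine ?(ltW xy)//; try exact: iS.
rewrite avg.
have yx0 : 0 < y - x by rewrite subr_gt0.
(* After division by a^p the three terms of [crossing] contribute at most D, - p D and (p - 1) D per
   unit of length, which add up to 0. *)
have := RH x y lx xy yr; rewrite avg mulfK ?gt_eqF// => h.
have ap0 : 0 < a `^ (- p) by rewrite powR_gt0.
have := ler_wpM2l (ltW ap0) h.
have -> : a `^ (- p) * (D * (y - x) * a `^ p) = D * (y - x).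
  by rewrite powRN; field; rewrite gt_eqF// powR_gt0.
have -> : - (p * D / a) * (a * (y - x)) = - (p * D * (y - x)).
  by field; rewrite gt_eqF.
lra.
Qed.

(** The discretisation error is of order 1/n, since exp (x / n) - 1 <= (x / n) exp x for n >= 1. *)
Lemma truncated_moment_error (c x m : R) : 0 <= c -> 0 <= x ->
  (forall n : nat, m <= c * (expR (x / n.+1%:R) - 1)) -> m <= 0.
Proof.
move=> c0 x0 H; apply/ler_addgt0Pr => e e0; rewrite add0r.
have M0 : 0 <= c * (x * expR x) by rewrite !mulr_ge0// expR_ge0.
pose n := Num.truncn (c * (x * expR x) / e).
apply: le_trans (H n) _.
have n0 : (0 : R) < n.+1%:R by rewrite ltr0n.
have xn0 : 0 <= x / n.+1%:R by rewrite divr_ge0// ltW.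
have h1 : expR (x / n.+1%:R) - 1 <= x / n.+1%:R * expR x.
  have /andP[_ h] := @expR_sub1_bounds R 1 (x / n.+1%:R) ltr01.
  rewrite mul1r divr1 in h; apply: le_trans h _.
  rewrite ler_wpM2l// ler_expR ler_pdivrMr// ler_peMr//.
  by rewrite ler1n.
apply: le_trans (ler_wpM2l c0 h1) _.
have -> : c * (x / n.+1%:R * expR x) = c * (x * expR x) / n.+1%:R.
  by rewrite -!mulrA (mulrC (expR x)).
rewrite ler_pdivrMr// [leRHS]mulrC -ler_pdivrMr//.
exact/ltW/truncnS_gt.
Qed.

(** Both powers of [a] decrease in [a], so the error at the lowest level of the mesh bounds the
    errors at all levels. *)
Lemma mesh_error_le p D s a b x g : 1 < p -> 0 <= D -> 0 < s -> 0 <= x ->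
  0 <= g -> 0 < b -> b <= a ->
  a `^ (- s) * (g * ((x / a) `^ p + (p - 1) * D)) <=
  b `^ (- s) * (g * ((x / b) `^ p + (p - 1) * D)).
Proof.
move=> p1 D0 s0 x0 g0 b0 ba.
have a0 : 0 < a by lra.
have pD0 : 0 <= (p - 1) * D by rewrite mulr_ge0// subr_ge0 ltW.
apply: ler_pM; first exact: powR_ge0.
- by rewrite mulr_ge0// addr_ge0// powR_ge0.
- rewrite !powRN lef_pV2 ?posrE ?powR_gt0//.
  by apply: ge0_ler_powR => //; rewrite ?nnegrE ltW.
- apply: ler_wpM2l => //; rewrite lerD2r; apply: ge0_ler_powR.
  + by rewrite ltW// (lt_trans ltr01).
  + by rewrite nnegrE divr_ge0// ltW.
  + by rewrite nnegrE divr_ge0// ltW.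
  + by rewrite ler_wpM2l// lef_pV2 ?posrE.
Qed.

Lemma truncated_moment p D Q s w l r A T :
  tangent_data p D Q -> 0 < s -> (Q - 1) * s < 1 -> l < r -> 0 < A -> 0 <= T ->
  (forall t, 0 <= w t) ->
  mu.-integrable setT (EFin \o w) ->
  mu.-integrable setT (EFin \o (fun t => w t `^ p)) ->
  \int[mu]_(t in `]l, r[) w t = A * (r - l) ->
  reverse_holder_Rintegral p D l r w ->
  \int[mu]_(t in `]l, r[) (Num.max (w t) (A * expR (- T)) `^ (- s)) <=
  (r - l) * ((A * Q) `^ (- s) / (1 - (Q - 1) * s)).
Proof.
move=> tD s0 sQ lr A0 T0 w0 wi wpi wA RH.
have [p1 D1 Q1 QE] := tD.
set e := A * expR (- T).
have e0 : 0 < e by rewrite mulr_gt0// expR_gt0.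
have mI := measurable_itv `]l, r[.
have wI : mu.-integrable `]l, r[ (EFin \o w) by apply: integrableS wi.
have wpI : mu.-integrable `]l, r[ (EFin \o (fun t => w t `^ p)).
  by apply: integrableS wpi.
have mw : measurable_fun `]l, r[ w.
  by have := measurable_int mu wI => /measurable_EFinP.
have lr0 : 0 < r - l by rewrite subr_gt0.
(* This is the place of (Q - 1) s < 1: the final step divides by [gauge_min]. *)
have km0 : 0 < gauge_min p D Q s.
  rewrite /gauge_min divr_gt0 ?mulr_gt0 ?powR_gt0//; lra.
pose LHS t := Num.max (w t) e `^ (- s).
have LHSi : mu.-integrable `]l, r[ (EFin \o LHS).
  apply: measurable_bounded_integrable => //.
  - by rewrite /= lebesgue_measure_itv/=; case: ifP => _; rewrite ?ltry.
  - apply: (measurableT_comp (@measurable_powR R (- s))).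
    by apply: measurable_maxr.
  - exists (e `^ (- s)); split; first by rewrite num_real.
    move=> M eM t _ /=; apply: le_trans (ltW eM).
    have mx0 : 0 < Num.max (w t) e by rewrite lt_max e0 orbT.
    have emx : e <= Num.max (w t) e by rewrite le_max lexx orbT.
    rewrite ger0_norm ?powR_ge0// /LHS !powRN lef_pV2 ?posrE ?powR_gt0//.
    by apply: ge0_ler_powR => //; rewrite ?nnegrE ltW.
pose P t := potential p D s (w t) A.
pose c1 := A `^ (- s) * (A `^ (- p) / (s + p)).
pose c2 := A `^ (- s) * - (p * D / (A * (s + 1))).
pose c3 := A `^ (- s) * ((p - 1) * D / s).
have PE : P = fun t => c1 * w t `^ p + c2 * w t + c3.
  by apply/funext => t; rewrite /P /potential gauge_affine// /c1 /c2 /c3; lra.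
have Pi : mu.-integrable `]l, r[ (EFin \o P).
  by rewrite PE; exact: integrable_affine.
(* The potential at level [A] is affine in w and w^p, so the reverse Hoelder inequality on the whole
   interval bounds its mean by A^(-s) D (1 / (s + p) - p / (s + 1) + (p - 1) / s). The bracket
   equals p (p - 1) / (s (s + 1) (s + p)), which makes this [gauge_min] times the claimed bound. *)
have Pint : \int[mu]_(t in `]l, r[) P t <= gauge_min p D Q s *
    ((r - l) * ((A * Q) `^ (- s) / (1 - (Q - 1) * s))).
  rewrite PE Rintegral_affine ?(ltW lr)// wA.
  have c10 : 0 <= c1.
    by rewrite /c1 mulr_ge0 ?powR_ge0// divr_ge0 ?powR_ge0//; lra.
  have := RH l r (lexx _) lr (lexx _); rewrite wA mulfK ?gt_eqF// => h.
  have := ler_wpM2l c10 h.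
  have -> : c1 * (D * (r - l) * A `^ p) = A `^ (- s) * D * (r - l) / (s + p).
    rewrite /c1 [A `^ (- p)]powRN; field.
    by rewrite !gt_eqF// ?powR_gt0//; lra.
  have -> : c2 * (A * (r - l)) = - (A `^ (- s) * p * D * (r - l) / (s + 1)).
    by rewrite /c2; field; rewrite !gt_eqF//; lra.
  have -> : gauge_min p D Q s *
      ((r - l) * ((A * Q) `^ (- s) / (1 - (Q - 1) * s))) =
      A `^ (- s) * D * (r - l) / (s + p) -
      A `^ (- s) * p * D * (r - l) / (s + 1) + c3 * (r - l).
    rewrite /c3 /gauge_min powRM ?(ltW A0)//; last lra.
    rewrite [Q `^ (- s)]powRN; field.
    rewrite !gt_eqF// ?powR_gt0//; lra.
  by lra.
(* The left side does not depend on the mesh, and the right side tends to 0 as the mesh is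
   refined. *)
suff main n : gauge_min p D Q s * \int[mu]_(t in `]l, r[) LHS t -
    \int[mu]_(t in `]l, r[) P t <=
    T * (e `^ (- s) * (e `^ (- p) * \int[mu]_(t in `]l, r[) (w t `^ p) +
      (p - 1) * D * (r - l))) * (expR ((s + p) * T / n.+1%:R) - 1).
  have wp0 : 0 <= \int[mu]_(t in `]l, r[) (w t `^ p).
    by apply: Rintegral_ge0 => t _; exact: powR_ge0.
  have : gauge_min p D Q s * \int[mu]_(t in `]l, r[) LHS t -
      \int[mu]_(t in `]l, r[) P t <= 0.
    apply: truncated_moment_error main.
      rewrite mulr_ge0// mulr_ge0 ?powR_ge0// addr_ge0//.
        by rewrite mulr_ge0 ?powR_ge0.
      by rewrite !mulr_ge0//; lra.
    by rewrite mulr_ge0//; lra.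
  move=> h; rewrite -(ler_pM2l km0); apply: le_trans Pint.
  by rewrite -subr_le0.
pose t := T / n.+1%:R.
have n0 : (0 : R) < n.+1%:R by rewrite ltr0n.
have t0 : 0 <= t by rewrite divr_ge0// ltW.
pose a i := A * expR (- (i%:R * t)).
have a0 i : 0 < a i by rewrite mulr_gt0// expR_gt0.
have aA i : a i <= A.
  by rewrite ger_pMr// -expR0 ler_expR oppr_le0 mulr_ge0.
have anE : a n.+1 = e.
  by congr (A * expR (- _)); rewrite /t mulrC divfK// gt_eqF.
have ea i : (i < n.+1)%N -> e <= a i.
  move=> iln; rewrite -anE ler_pM2l// ler_expR lerN2 ler_wpM2r//.
  by rewrite ler_nat ltnW.
have /choice[E HE] : forall i, exists E : set (measurableTypeR R),
    [/\ measurable E, E `<=` `]l, r[,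
    {ae mu, forall t, `]l, r[%classic t -> ~ E t -> a i <= w t} &
    (\int[mu]_(t in E) (crossing p D (w t / a i))%:E <= 0)%E].
  by move=> i; exact: (reverse_holder_low_set tD lr (a0 i) (aA i)).
pose c i := t * a i `^ (- s).
have c0 i : 0 <= c i by rewrite mulr_ge0 ?powR_ge0.
have gi i : mu.-integrable `]l, r[ (EFin \o (fun u => crossing p D (w u / a i))).
  have -> : (fun u => crossing p D (w u / a i)) = (fun u =>
      a i `^ (- p) * w u `^ p + (- (p * D / a i)) * w u + (p - 1) * D).
    by apply/funext => u; rewrite crossing_affine.
  exact: integrable_affine.
have [|||Si S0] := @Rintegral_sum_restrict_le0 R l r n.+1 c
  (fun i u => crossing p D (w u / a i)) E c0 _ _ gi.
- by move=> i; have [] := HE i.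
- by move=> i; have [] := HE i.
- by move=> i; have [] := HE i.
pose S u := \sum_(i < n.+1) (c i * crossing p D (w u / a i)) *+ (u \in E i).
have {}Si : mu.-integrable `]l, r[ (EFin \o S) := Si.
have {}S0 : \int[mu]_(u in `]l, r[) S u <= 0 := S0.
pose g := expR ((s + p) * t) - 1.
have g0 : 0 <= g.
  by rewrite subr_ge0 -expR0 ler_expR mulr_ge0//; lra.
pose K u := e `^ (- s) * (g * ((w u / e) `^ p + (p - 1) * D)).
pose d1 := e `^ (- s) * g * e `^ (- p).
pose d3 := e `^ (- s) * g * ((p - 1) * D).
have KE : K = fun u => d1 * w u `^ p + 0 * w u + d3.
  by apply/funext => u; rewrite /K powR_div// /d1 /d3; lra.
have Ki : mu.-integrable `]l, r[ (EFin \o K).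
  by rewrite KE; exact: integrable_affine.
pose h u := P u + S u + n.+1%:R * t * K u - gauge_min p D Q s * LHS u.
have nKi : mu.-integrable `]l, r[ (EFin \o (fun u => n.+1%:R * t * K u)).
  exact: integrable_EFinM.
have PSi : mu.-integrable `]l, r[ (EFin \o (fun u => P u + S u)).
  exact: integrable_EFinD.
have PSKi : mu.-integrable `]l, r[
    (EFin \o (fun u => P u + S u + n.+1%:R * t * K u)).
  exact: integrable_EFinD.
have kLi : mu.-integrable `]l, r[ (EFin \o (fun u => gauge_min p D Q s * LHS u)).
  exact: integrable_EFinM.
have hi : mu.-integrable `]l, r[ (EFin \o h).
  have -> : h = fun u => P u + S u + n.+1%:R * t * K u +
      (-1) * (gauge_min p D Q s * LHS u).
    by apply/funext => u; rewrite /h mulN1r.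
  by apply: integrable_EFinD => //; exact: integrable_EFinM.
have h0 : 0 <= \int[mu]_(u in `]l, r[) h u.
  apply: Rintegral_ae_ge0 => //.
  have /ae_forall_nat : forall i,
      {ae mu, forall u, `]l, r[%classic u -> ~ E i u -> a i <= w u}.
    by move=> i; have [] := HE i.
  apply: filterS; first exact: (ae_filter_ringOfSetsType mu).
  move=> u Eu Iu; rewrite /h subr_ge0 /S /LHS /P.
  have K0 : 0 <= K u.
    apply: mulr_ge0; first exact: powR_ge0.
    apply: mulr_ge0 g0 _; apply: addr_ge0; first exact: powR_ge0.
    by rewrite mulr_ge0 ?(le_trans ler01 D1)// subr_ge0 ltW.
  have := @potential_mesh R p D Q s (w u) A t (K u) n.+1
    (fun i => u \in E i) tD s0 (w0 u) A0 t0 K0.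
  rewrite -/(a _) anE => /(_ _ _)/le_trans; apply.
  - move=> i _ uE; apply: Eu => //.
    by move=> Eiu; move/negP: uE; apply; rewrite inE.
  - move=> i iln; rewrite -/(a i).
    apply: mesh_error_le (ea _ iln) => //.
    by rewrite (le_trans ler01).
  rewrite lerD2r lerD2l ler_sum// => i _.
  by rewrite /c -mulrA lexx.
have hE : \int[mu]_(u in `]l, r[) h u = \int[mu]_(u in `]l, r[) P u +
    \int[mu]_(u in `]l, r[) S u + n.+1%:R * t * \int[mu]_(u in `]l, r[) K u -
    gauge_min p D Q s * \int[mu]_(u in `]l, r[) LHS u.
  rewrite /h RintegralB//. rewrite RintegralD// RintegralD//.
  by rewrite RintegralZl// RintegralZl.
have KintE : n.+1%:R * t * \int[mu]_(u in `]l, r[) K u =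
    T * (e `^ (- s) * (e `^ (- p) * \int[mu]_(t in `]l, r[) (w t `^ p) +
      (p - 1) * D * (r - l))) * (expR ((s + p) * T / n.+1%:R) - 1).
  rewrite KE Rintegral_affine ?(ltW lr)// /d1 /d3 /g.
  have -> : n.+1%:R * t = T by rewrite /t mulrC divfK// gt_eqF.
  have -> : (s + p) * t = (s + p) * T / n.+1%:R by rewrite /t mulrA.
  by rewrite mul0r addr0; ring.
move: h0; rewrite hE KintE subr_ge0 => h0.
rewrite lerBlDl; apply: le_trans h0 _.
by rewrite -addrA lerD2l gerDr.
Qed.

End truncated_moment.

Section negative_moment.
Context {R : realType}.
Local Notation mu := (@lebesgue_measure R).
Implicit Types (p D Q s l r A : R) (w : R -> R).

(** For x > 0 the truncation is eventually inactive. For x = 0 the sequence is A^(-s) exp (s k),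
    whose limit +oo is the value that [epow] assigns. *)
Lemma cvg_truncated_powR A s x : 0 < A -> 0 < s -> 0 <= x ->
  (Num.max x (A * expR (- k%:R)) `^ (- s))%:E @[k --> \oo] --> epow x (- s).
Proof.
move=> A0 s0; rewrite le_eqVlt => /predU1P[<-|x0].
  rewrite /epow eqxx oppr_lt0 s0/=.
  have E k : Num.max 0 (A * expR (- k%:R)) `^ (- s) =
      A `^ (- s) * expR (s * k%:R).
    rewrite (max_idPr _) ?mulr_ge0 ?expR_ge0 ?(ltW A0)//.
    by rewrite powRM ?expR_ge0 ?(ltW A0)// -expRM mulrNN mulrC [s * _]mulrC mulrC.
  apply/cvgeyPge => M; near=> k.
  rewrite E lee_fin -ler_pdivrMl ?powR_gt0//.
  apply: le_trans (expR_ge1Dx _); apply: ler_wpDl => //.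
  rewrite -ler_pdivrMl//.
  by near: k; exact: nbhs_infty_ger.
rewrite /epow gt_eqF//=; apply: cvg_near_cst; near=> k.
rewrite (max_idPl _)//.
have /(le_trans _) : ln (A / x) <= k%:R by near: k; exact: nbhs_infty_ger.
move=> /(_ (ln (A / x)) (lexx _)) h.
rewrite expRN ler_pdivrMr ?expR_gt0// mulrC -ler_pdivrMr//.
by rewrite -[leLHS](@lnK R) ?posrE ?divr_gt0// ler_expR.
Unshelve. all: by end_near. Qed.

Lemma negative_moment p D Q s w l r A :
  tangent_data p D Q -> 0 < s -> (Q - 1) * s < 1 -> l < r -> 0 < A ->
  (forall t, 0 <= w t) ->
  mu.-integrable setT (EFin \o w) ->
  mu.-integrable setT (EFin \o (fun t => w t `^ p)) ->
  \int[mu]_(t in `]l, r[) w t = A * (r - l) ->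
  reverse_holder_Rintegral p D l r w ->
  (\int[mu]_(t in `]l, r[) epow (w t) (- s)%R <=
   ((r - l) * ((A * Q) `^ (- s) / (1 - (Q - 1) * s)))%:E)%E.
Proof.
move=> tD s0 sQ lr A0 w0 wi wpi wA RH.
have mI := measurable_itv `]l, r[.
have mw : measurable_fun `]l, r[ w.
  have : mu.-integrable `]l, r[ (EFin \o w) by apply: integrableS wi.
  by move=> /(measurable_int mu)/measurable_EFinP.
pose u k t := Num.max (w t) (A * expR (- k%:R)) `^ (- s).
pose g k t := (u k t)%:E.
have mu_ k : measurable_fun `]l, r[ (u k).
  apply: (measurableT_comp (@measurable_powR R (- s))).
  by apply: measurable_maxr.
have mg k : measurable_fun `]l, r[ (g k) by apply/measurable_EFinP.
have g0 k t : `]l, r[%classic t -> (0 <= g k t)%E.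
  by move=> _; rewrite lee_fin powR_ge0.
have e0 k : 0 < A * expR (- k%:R) by rewrite mulr_gt0// expR_gt0.
have ndg t : `]l, r[%classic t ->
    {homo g ^~ t : n m / (n <= m)%N >-> (n <= m)%E}.
  move=> _ n m nm; rewrite lee_fin /u !powRN lef_pV2 ?posrE ?powR_gt0//; last 2 first.
  - by rewrite lt_max e0 orbT.
  - by rewrite lt_max e0 orbT.
  apply: ge0_ler_powR; first exact: ltW.
  - by rewrite nnegrE le_max w0.
  - by rewrite nnegrE le_max w0.
  rewrite ge_max !le_max lexx/= ler_pM2l// ler_expR lerN2 ler_nat nm.
  by rewrite orbT.
have ui k : mu.-integrable `]l, r[ (EFin \o u k).
  apply: measurable_bounded_integrable => //.
  - by rewrite /= lebesgue_measure_itv/=; case: ifP => _; rewrite ?ltry.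
  - exact: mu_.
  - exists ((A * expR (- k%:R)) `^ (- s)); split; first by rewrite num_real.
    move=> M eM t _ /=; apply: le_trans (ltW eM).
    have mx0 : 0 < Num.max (w t) (A * expR (- k%:R)) by rewrite lt_max e0 orbT.
    have emx : A * expR (- k%:R) <= Num.max (w t) (A * expR (- k%:R)).
      by rewrite le_max lexx orbT.
    rewrite ger0_norm ?powR_ge0// /u !powRN lef_pV2 ?posrE ?powR_gt0//.
    by apply: ge0_ler_powR => //; rewrite ?nnegrE ltW.
have -> : (\int[mu]_(t in `]l, r[) epow (w t) (- s)%R =
    \int[mu]_(t in `]l, r[) limn (g ^~ t))%E.
  apply: eq_integral => t _; apply/esym/cvg_lim => //.
  exact: cvg_truncated_powR.
have cvgI : (\int[mu]_(t in `]l, r[) g n t)%E @[n --> \oo] -->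
    (\int[mu]_(t in `]l, r[) limn (g ^~ t))%E.
  exact: cvg_monotone_convergence.
rewrite -(cvg_lim _ cvgI)//; apply: lime_le; first exact: cvgP cvgI.
apply: nearW => k.
rewrite -(@fineK _ (\int[mu]_(t in _) _)%E); last exact: integrable_fin_num (ui k).
rewrite lee_fin.
exact: (truncated_moment tD s0 sQ lr A0 (ler0n _ k) w0 wi wpi wA RH).
Qed.

End negative_moment.

(** * From Lebesgue to Borel measurable weights *)

Section lebesgue_to_borel.
Context {R : realType}.
Local Notation mu := (@lebesgue_measure R).
Local Notation leb := (@completed_lebesgue_measure R).

Lemma borel_lebesgue_measurable (A : set (measurableTypeR R)) :
  measurable A -> @measurable _ (lebesgue_line R) A.
Proof. exact: sub_caratheodory. Qed.

Lemma measurable_idfun_lebesgue_borel :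
  @measurable_fun _ _ (lebesgue_line R) (measurableTypeR R) setT idfun.
Proof.
by move=> _ A mA; rewrite setTI; exact: borel_lebesgue_measurable.
Qed.

Lemma completed_lebesgue_measureE (A : set R) : leb A = mu A.
Proof. by []. Qed.

(** The identity map from the Lebesgue to the Borel line is measurable and pushes the completed
    measure to [mu]; the claim is the change of variables along it. *)
Lemma ge0_integral_completed (f : R -> \bar R) (D : set R) :
  @measurable _ (measurableTypeR R) D ->
  @measurable_fun _ _ (measurableTypeR R) (\bar R) D f ->
  (forall x, D x -> 0 <= f x)%E ->
  (\int[leb]_(t in D) f t = \int[mu]_(t in D) f t)%E.
Proof.
move=> mD mf f0.
have f0' : {in D, forall y, (0 <= f y)%E} by move=> y; rewrite inE => /f0.
have <- := @ge0_integral_pushforward _ _ (lebesgue_line R) (measurableTypeR R)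
  R idfun measurable_idfun_lebesgue_borel leb D f mD mf f0'.
apply: eq_measure_integral.
  by move=> A mA; rewrite setTI; exact: borel_lebesgue_measurable.
by move=> ? A mA AD.
Qed.

Lemma integral_completed (f : R -> \bar R) (D : set R) :
  @measurable _ (measurableTypeR R) D ->
  @measurable_fun _ _ (measurableTypeR R) (\bar R) D f ->
  (\int[leb]_(t in D) f t = \int[mu]_(t in D) f t)%E.
Proof.
move=> mD mf; rewrite integralE [RHS]integralE; congr (_ - _)%E.
  by apply: ge0_integral_completed => //; exact: measurable_funepos.
by apply: ge0_integral_completed => //; exact: measurable_funeneg.
Qed.

(** The Caratheodory sets form the completion of the Borel sets, so [A] is the union of a Borel set
    and a part of a Borel null set. *)
Lemma lebesgue_measurable_ae_borel (A : set R) :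
  @measurable _ (lebesgue_line R) A ->
  exists2 N : set (measurableTypeR R), measurable N /\ mu N = 0%E &
    @measurable _ (measurableTypeR R) (A `\` N).
Proof.
move=> mA.
have : (completed_algebra_gen mu).-sigma.-measurable A.
  by rewrite completed_caratheodory_measurable.
rewrite g_sigma_completed_algebra_genE => -[B mB [M [N [mN N0 MN]]] <-].
exists N => //.
have -> : (B `|` M) `\` N = B `\` N.
  apply/seteqP; split => x [].
    by move=> [//|/MN].
  by move=> Bx nNx; split => //; left.
exact: measurableD.
Qed.

Lemma borel_representative (D : set R) (w : R -> R) :
  @measurable _ (measurableTypeR R) D ->
  @measurable_fun _ _ (lebesgue_line R) (measurableTypeR R) D w ->
  exists2 N : set (measurableTypeR R), measurable N /\ mu N = 0%E &
    @measurable_fun _ _ (measurableTypeR R) (measurableTypeR R) (D `\` N) w.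
Proof.
move=> mD mw.
(* An enumeration of the rationals, with value 0 at the numbers that code none. Removing the
   exceptional null sets of these countably many levels settles all levels, each open half-line
   being the union of the rational ones inside it. *)
pose q (n : nat) : R := ratr (odflt 0 (unpickle n) : rat).
have mq n : @measurable _ (lebesgue_line R) (D `&` w @^-1` `]q n, +oo[).
  by apply: mw; [exact: borel_lebesgue_measurable|exact: measurable_itv].
pose N n := sval (cid2 (lebesgue_measurable_ae_borel (mq n))).
have NP n : measurable (N n) /\ mu (N n) = 0%E.
  by rewrite /N; case: cid2.
have mN n : @measurable _ (measurableTypeR R)
    ((D `&` w @^-1` `]q n, +oo[) `\` N n).
  by rewrite /N; case: cid2.
have mM : @measurable _ (measurableTypeR R) (\bigcup_n N n).
  by apply: bigcupT_measurable => n; have [] := NP n.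
exists (\bigcup_n N n).
  split => //; apply/eqP; rewrite -measure_le0.
  have /negligibleP-> // : mu.-negligible (\bigcup_n N n).
  apply: negligible_bigcup => n; exists (N n).
  by have [mNn Nn0] := NP n; split.
apply: (measurability _ (RGenOInfty.measurableE R)) => //.
move=> _ [_ [x ->] <-].
have -> : (D `\` \bigcup_n N n) `&` w @^-1` `]x, +oo[ =
    \bigcup_(n in [set n | x <= q n])
      (((D `&` w @^-1` `]q n, +oo[) `\` N n) `\` \bigcup_n N n).
  apply/seteqP; split => t.
    move=> [[Dt nNt]] /=; rewrite in_itv/= andbT => /rat_in_itvoo[u].
    rewrite in_itv/= => /andP[xu uw].
    have qu : q (pickle u) = ratr u by rewrite /q pickleK.
    exists (pickle u) => /=; first by rewrite qu ltW.
    split => //; split; last by move=> Nt; apply: nNt; exists (pickle u).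
    by split => //=; rewrite in_itv/= andbT qu.
  move=> [n /= xq [[[Dt wt] _] nNt]]; split => //=.
  by move: wt; rewrite /= !in_itv/= !andbT; exact: le_lt_trans.
by apply: bigcup_measurable => n _; exact: measurableD.
Qed.

End lebesgue_to_borel.

(** * Averages over intervals and Borel representatives of weights *)

Section averages.
Context {R : realType}.
Local Notation mu := (@lebesgue_measure R).
Local Notation leb := (@completed_lebesgue_measure R).
Implicit Types (I J : set R) (v w : R -> R) (phi : R -> \bar R).

Lemma bounded_interval_itv J : bounded_interval J -> exists a b x y,
  x < y /\ J = [set` Interval (BSide a x) (BSide b y)].
Proof.
move=> [iJ bJ [x0 [y0 [Jx Jy xy]]]].
have J0 : J !=set0 by exists x0.
have [M [_ JM]] := bJ.
have JM1 z : J z -> `|z| <= M + 1 by apply: JM; rewrite ltrDl.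
have lJ : has_lbound J.
  by exists (- (M + 1)) => z /JM1; rewrite ler_norml => /andP[].
have uJ : has_ubound J.
  by exists (M + 1) => z /JM1; rewrite ler_norml => /andP[].
have /is_intervalP JE := iJ.
exists `[< J (inf J) >], (~~ `[< J (sup J) >]), (inf J), (sup J); split.
  apply: (@le_lt_trans _ _ x0); first exact: ge_inf.
  by apply: (lt_le_trans xy); exact: ub_le_sup.
rewrite [LHS]JE /Rhull.
by rewrite (asboolT lJ) (asboolT uJ).
Qed.

Lemma itv_bounded_interval a b (x y : R) : x < y ->
  bounded_interval [set` Interval (BSide a x) (BSide b y)].
Proof.
move=> xy; split; first exact: interval_is_interval.
- exists (`|x| + `|y|); split; first by rewrite num_real.
  move=> M xyM z /= zxy; apply/ltW/(le_lt_trans _ xyM).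
  have /andP[xz zy] : x <= z <= y.
    by move: zxy; case: (a); case: (b); rewrite in_itv/= => /andP[];
      do ?[move=> /ltW -> /ltW ->|move=> -> /ltW ->|move=> /ltW -> ->|move=> -> ->].
  rewrite ler_norml; apply/andP; split.
    have := ler_norm (- x); rewrite normrN; have := normr_ge0 y; lra.
  have := ler_norm y; have := normr_ge0 x; lra.
- exists (x + (y - x) / 3), (x + (y - x) * 2 / 3).
  by case: (a); case: (b); rewrite /= !in_itv/=; split;
    rewrite ?andbT; try (apply/andP; split); lra.
Qed.

Lemma completed_lebesgue_itv a b (x y : R) : x < y ->
  leb [set` Interval (BSide a x) (BSide b y)] = (y - x)%:E.
Proof.
by move=> xy; rewrite completed_lebesgue_measureE lebesgue_measure_itv/= lte_fin
  xy EFinB.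
Qed.

Lemma averageE phi a b (x y : R) : x < y ->
  @measurable_fun _ _ (measurableTypeR R) _ setT phi ->
  average phi [set` Interval (BSide a x) (BSide b y)] =
  ((\int[mu]_(t in `]x, y[) phi t) * (y - x)^-1%:E)%E.
Proof.
move=> xy mphi; rewrite /average completed_lebesgue_itv//.
rewrite inver gt_eqF ?subr_gt0//; congr (_ * _)%E.
rewrite integral_completed//; last exact: measurable_funTS.
by rewrite integral_itv_bndoo//; exact: measurable_funTS.
Qed.

Lemma measurable_epow (r : R) : measurable_fun setT (fun u : R => epow u r).
Proof.
rewrite /epow; have [r0|r0] := ltP r 0; last first.
  under eq_fun do rewrite andbF.
  by apply/measurable_EFinP; exact: measurable_powR.
under eq_fun do rewrite andbT.
apply: measurable_fun_ifT => //; last first.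
  by apply/measurable_EFinP; exact: measurable_powR.
by apply: measurable_fun_eqr.
Qed.

Lemma measurable_lne_EFin : measurable_fun setT (fun u : R => lne u%:E).
Proof.
rewrite /lne; apply: measurable_fun_ifT => //.
  by apply: measurable_fun_ler.
by apply/measurable_EFinP; exact: measurable_ln.
Qed.

(** Extension by 0 gives a function measurable on the whole line. The arbitrary [phi] lets one
    representative serve the powers and the logarithm alike: changing w on a null set leaves every
    average alone, even where a negative power becomes +oo. *)
Lemma weight_representative I w : bounded_interval I -> weight I w ->
  exists v, [/\ @measurable_fun _ _ (measurableTypeR R) (measurableTypeR R) setT v,
    forall t, 0 <= v t, forall t, ~ I t -> v t = 0 &
    forall J phi, subinterval I J -> measurable_fun setT phi ->
      average (phi \o w) J = average (phi \o v) J].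
Proof.
move=> bI [mw w0].
have mI : @measurable _ (measurableTypeR R) I.
  by have [a [b [x [y [_ ->]]]]] := bounded_interval_itv bI.
have [N [mN N0] mwN] := borel_representative mI mw.
have mIN : @measurable _ (measurableTypeR R) (I `\` N) by exact: measurableD.
exists (w \_ (I `\` N)).
have mv : @measurable_fun _ _ (measurableTypeR R) (measurableTypeR R) setT
  (w \_ (I `\` N)) by apply/(measurable_restrictT _ _).1.
split => //.
- move=> t; rewrite patchE; case: ifPn => // /set_mem[It _]; exact: w0.
- move=> t nIt; rewrite patchE; case: ifPn => // /set_mem[It _]; case: (nIt It).
move=> J phi [bJ JI] mphi; rewrite /average; congr (_ / _)%E.
have mJ : @measurable _ (measurableTypeR R) J.
  by have [a [b [x [y [_ ->]]]]] := bounded_interval_itv bJ.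
have mJ' := borel_lebesgue_measurable mJ.
apply: ae_eq_integral => //.
- apply: (@measurable_comp _ _ _ (lebesgue_line R) (measurableTypeR R)) mphi _ => //.
  apply: measurable_funS mw => //.
  exact: borel_lebesgue_measurable.
- apply: (@measurable_comp _ _ _ (lebesgue_line R) (measurableTypeR R)) mphi _ => //.
  apply: (@measurable_comp _ _ _ (lebesgue_line R) (measurableTypeR R)) mv _ => //.
  by apply: measurable_funTS; exact: measurable_idfun_lebesgue_borel.
- exists N; split => //; first exact: borel_lebesgue_measurable.
  move=> t /= /not_implyP[Jt]; apply: contra_notP => nNt.
  by rewrite patchE mem_set//; split => //; exact: JI.
Qed.

End averages.

Section negative_moment_average.
Context {R : realType}.
Local Notation mu := (@lebesgue_measure R).
Implicit Types (J : set R) (v w u : R -> R).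

Lemma integrable_supported u a b (x y : R) : x < y ->
  @measurable_fun _ _ (measurableTypeR R) (measurableTypeR R) setT u ->
  (forall t, 0 <= u t) ->
  (forall t, ~ [set` Interval (BSide a x) (BSide b y)] t -> u t = 0) ->
  (\int[mu]_(t in `]x, y[) (u t)%:E < +oo)%E ->
  mu.-integrable setT (EFin \o u).
Proof.
move=> xy mu_ u0 uJ uoo; apply/integrableP; split; first exact/measurable_EFinP.
set J := [set` _] in uJ.
have -> : (fun t => `|(EFin \o u) t|%E) = (fun t => (u t)%:E) \_ J.
  apply/funext => t; rewrite patchE /= ger0_norm//.
  by case: ifPn => //; rewrite notin_setE => /uJ ->.
rewrite -integral_mkcond/= integral_itv_bndoo//.
by apply/measurable_EFinP; exact: measurable_funTS.
Qed.

Lemma reverse_holder_borel (p delta : R) J w : 1 < p -> 1 <= delta ->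
  bounded_interval J -> reverse_holder p delta J w ->
  exists l r v A,
    [/\ l < r /\ 0 < A, forall t, 0 <= v t,
      mu.-integrable setT (EFin \o v) /\
      mu.-integrable setT (EFin \o (fun t => v t `^ p)),
      \int[mu]_(t in `]l, r[) v t = A * (r - l) /\
      reverse_holder_Rintegral p (delta `^ p) l r v &
      average (EFin \o w) J = A%:E /\
      forall phi, measurable_fun setT phi ->
        average (phi \o w) J =
        ((\int[mu]_(t in `]l, r[) phi (v t)) * (r - l)^-1%:E)%E].
Proof.
move=> p1 d1 bJ [wJ RH].
have [v [mv v0 vJ vw]] := weight_representative bJ wJ.
have [a [b [l [r [lr JE]]]]] := bounded_interval_itv bJ.
have p0 : 0 < p by lra.
have mvp : @measurable_fun _ _ (measurableTypeR R) (measurableTypeR R) setT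
    (fun t => v t `^ p).
  by apply: (measurableT_comp (@measurable_powR R p)).
have epowE x : epow x p = (x `^ p)%:E.
  by rewrite /epow ltNge (ltW p0) andbF.
have mepow : measurable_fun setT (fun c : R => epow c p) by exact: measurable_epow.
have mE : measurable_fun setT (@EFin R).
  by apply/measurable_EFinP; exact: measurable_id.
have mphiv (phi : R -> \bar R) : measurable_fun setT phi ->
    @measurable_fun _ _ (measurableTypeR R) _ setT (phi \o v).
  by move=> mphi; apply: (@measurable_comp _ _ _ (measurableTypeR R) (measurableTypeR R)) mphi mv.
have mvE := mphiv _ mE.
have mvp' := mphiv _ mepow.
have oo_sub x y : l <= x -> x < y -> y <= r -> `]x, y[%classic `<=` J.
  move=> lx xy yr z /=; rewrite JE/= in_itv/= => /andP[xz zy].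
  by case: (a); case: (b); rewrite in_itv/=; apply/andP; split; lra.
have avgs x y : l <= x -> x < y -> y <= r ->
    (\int[mu]_(t in `]x, y[) (v t)%:E < +oo /\
     0 < \int[mu]_(t in `]x, y[) (v t)%:E /\
     ((\int[mu]_(t in `]x, y[) (v t `^ p)%:E) * (y - x)^-1%:E) `^ p^-1 /
       ((\int[mu]_(t in `]x, y[) (v t)%:E) * (y - x)^-1%:E) <= delta%:E)%E.
  move=> lx xy yr.
  have sub : subinterval J `]x, y[%classic.
    by split; [exact: itv_bounded_interval|exact: oo_sub].
  have [] := RH _ sub; rewrite (vw _ EFin sub mE).
  rewrite (vw _ (fun c : R => epow c p) sub mepow) !averageE//.
  have -> : (\int[mu]_(t in `]x, y[) ((fun c : R => epow c p) \o v) t =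
      \int[mu]_(t in `]x, y[) (v t `^ p)%:E)%E.
    by apply: eq_integral => t _; rewrite /= epowE.
  move=> /andP[h0 hoo] h; split; last split => //.
  - by move: hoo; rewrite lte_pdivrMr ?subr_gt0// mulyr gtr0_sg ?subr_gt0// mul1e.
  - by move: h0; rewrite lte_pdivlMr ?subr_gt0// mul0e.
have rl0 : 0 < r - l by rewrite subr_gt0.
have [voo [v_gt0 vle]] := avgs l r (lexx _) lr (lexx _).
have JE' := JE; rewrite JE in vJ.
have vi := integrable_supported lr mv v0 vJ voo.
have iS u x y : mu.-integrable setT (EFin \o u) ->
    mu.-integrable `]x, y[ (EFin \o u).
  by move=> ui; apply: integrableS ui.
have vE x y : (\int[mu]_(t in `]x, y[) (v t)%:E =
    (\int[mu]_(t in `]x, y[) v t)%:E)%E.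
  by rewrite /Rintegral fineK//; apply: integrable_fin_num => //; exact: iS.
have vpi : mu.-integrable setT (EFin \o (fun t => v t `^ p)).
  apply: (@integrable_supported (fun t => v t `^ p) a b l r lr mvp) => [t|t nJt|].
  - exact: powR_ge0.
  - by rewrite (vJ _ nJt) powR0// gt_eqF.
  rewrite ltey; apply/eqP => voo'; move: vle.
  rewrite voo' gt0_mulye ?lte_fin ?invr_gt0// poweRyr ?gt_eqF ?invr_gt0//.
  rewrite vE -EFinM inver ifF; last first.
    apply/negbTE; rewrite mulf_neq0 ?invr_eq0 ?gt_eqF//.
    by rewrite -lte_fin -vE.
  rewrite gt0_mulye ?leye_eq// lte_fin invr_gt0 divr_gt0//.
  by rewrite -lte_fin -vE.
have vpE x y : (\int[mu]_(t in `]x, y[) (v t `^ p)%:E =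
    (\int[mu]_(t in `]x, y[) (v t `^ p))%:E)%E.
  by rewrite /Rintegral fineK//; apply: integrable_fin_num => //; exact: iS.
pose A := (\int[mu]_(t in `]l, r[) v t) / (r - l).
exists l, r, v, A; split => //.
- by split => //; rewrite divr_gt0// -lte_fin -vE.
- split; first by rewrite divfK// gt_eqF.
  move=> x y lx xy yr.
  have [_ [vxy0 vxy]] := avgs x y lx xy yr.
  have yx0 : 0 < y - x by rewrite subr_gt0.
  move: vxy vxy0; rewrite vE vpE lte_fin -!EFinM poweR_EFin => vxy vxy0.
  set V := \int[mu]_(t in _) v t in vxy vxy0 *.
  set W := \int[mu]_(t in _) _ in vxy *.
  have Vyx : 0 < V / (y - x) by rewrite divr_gt0.
  have W0 : 0 <= W by apply: Rintegral_ge0 => t _; exact: powR_ge0.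
  have Wyx : 0 <= W / (y - x) by rewrite divr_ge0// ltW.
  move: vxy; rewrite inver gt_eqF// -EFinM lee_fin ler_pdivrMr// => h.
  have : (W / (y - x)) `^ p^-1 `^ p <= (delta * (V / (y - x))) `^ p.
    apply: ge0_ler_powR => //; first exact: ltW.
    - by rewrite nnegrE powR_ge0.
    - by rewrite nnegrE mulr_ge0 ?(ltW Vyx)// (le_trans ler01).
  rewrite -powRrM mulVf ?gt_eqF// powRr1// powRM ?(ltW Vyx)//; last lra.
  by rewrite ler_pdivrMr// mulrAC.
have subJ : subinterval J J by split.
have avgE phi : measurable_fun setT phi -> average (phi \o w) J =
    ((\int[mu]_(t in `]l, r[) phi (v t)) * (r - l)^-1%:E)%E.
  move=> mphi; rewrite vw// [in LHS]JE' averageE//.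
  exact: mphiv.
split => //.
by rewrite avgE ?vE//; exact: mE.
Qed.

Lemma negative_moment_average (p delta Q s : R) J w :
  1 < p -> 1 <= delta -> tangent_data p (delta `^ p) Q ->
  0 < s -> (Q - 1) * s < 1 ->
  bounded_interval J -> reverse_holder p delta J w ->
  exists A, [/\ 0 < A, average (EFin \o w) J = A%:E &
    (average (fun t => epow (w t) (- s)%R) J <=
      ((A * Q) `^ (- s) / (1 - (Q - 1) * s))%:E)%E].
Proof.
move=> p1 d1 tD s0 sQ bJ RH.
have [l [r [v [A [[lr A0] v0 [vi vpi] [vA RHv] [wA avgE]]]]]] :=
  reverse_holder_borel p1 d1 bJ RH.
exists A; split => //.
rewrite (avgE (fun c : R => epow c (- s)) (measurable_epow _)).
rewrite lee_pdivrMr ?subr_gt0// -EFinM mulrC.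
exact: (negative_moment tD s0 sQ lr A0 v0 vi vpi vA RHv).
Qed.

End negative_moment_average.

(** * Upper bounds for the constants, at finite exponents and at infinity *)

Section upper_bounds.
Context {R : realType}.
Implicit Types (p delta q Q s : R) (I J : set R) (w : R -> R).

Lemma critical_exponent_tangent p delta : 1 < p -> 1 <= delta ->
  tangent_data p (delta `^ p) (critical_exponent p delta).
Proof.
move=> p1; rewrite le_eqVlt => /predU1P[<-|d1].
  rewrite /critical_exponent eqxx powR1; split => //.
  by rewrite powR1; lra.
have d0 : 0 < delta by lra.
have dp1 : 1 <= delta `^ p.
  have <- : (1 : R) `^ p = 1 by rewrite powR1.
  apply: ge0_ler_powR; rewrite ?nnegrE//; lra.
rewrite /critical_exponent gt_eqF//.
have [x [[x1 xE] _]] := critical_exponent_unique p1 d1.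
have [Q1] : critical_equation p delta (xget 1 (critical_equation p delta)).
  by apply: xgetPex; exists x.
move: (xget _ _) Q1 => Q Q1 QE; split => //; first exact: ltW.
have Q10 : Q - 1 != 0 by rewrite gt_eqF// subr_gt0.
have := congr1 (fun z => z * (Q - 1) + 1) QE; rewrite divfK// subrK.
rewrite powR_div//; last lra.
rewrite powRN => /(congr1 ( *%R (delta `^ p))).
rewrite mulVKf ?gt_eqF ?powR_gt0// => ->.
by congr (_ * _); lra.
Qed.

Lemma reverse_holderS p delta I J w : bounded_interval I -> subinterval I J ->
  reverse_holder p delta I w -> reverse_holder p delta J w.
Proof.
move=> bI [bJ JI] [[mw w0] RH]; split.
- split; last by move=> t /JI/w0.
  apply: measurable_funS mw => //.
  have [a [b [x [y [_ ->]]]]] := bounded_interval_itv bI.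
  by apply: borel_lebesgue_measurable; exact: measurable_itv.
- by move=> K [bK KJ]; apply: RH; split => // t /KJ/JI.
Qed.

Lemma Aq_constant_le p delta q I w : 1 < p -> 1 <= delta ->
  bounded_interval I -> reverse_holder p delta I w -> 1 < q ->
  (Aq_constant I q w <= Cq p delta q)%E.
Proof.
move=> p1 d1 bI RH q1; rewrite /Cq /=.
case: (leP q) => [_|qsq]; first by rewrite leey.
have tD := critical_exponent_tangent p1 d1.
move: (critical_exponent p delta) qsq tD => Q Qq tD.
have [_ _ Q1 _] := tD.
apply: ge_ereal_sup => _ [J sJ <-].
(* Then s = q' - 1, and q > Q becomes (Q - 1) s < 1. *)
pose s := (q - 1)^-1.
have q10 : 0 < q - 1 by lra.
have s0 : 0 < s by rewrite invr_gt0.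
have sQ : (Q - 1) * s < 1 by rewrite /s ltr_pdivrMr// mul1r; lra.
have [A [A0 -> le]] := negative_moment_average p1 d1 tD s0 sQ sJ.1
  (reverse_holderS bI sJ RH).
have -> : 1 - conjugate_exponent q = - s.
  by rewrite /conjugate_exponent /s; field; lra.
have avg0 : (0 <= average (fun t => epow (w t) (- s)%R) J)%E.
  apply: mule_ge0; last by rewrite inve_ge0.
  apply: integral_ge0 => t _.
  by rewrite /epow; case: ifP => _; rewrite ?leey// lee_fin powR_ge0.
have AQ0 : 0 < A * Q by rewrite mulr_gt0//; lra.
have D0 : 0 < 1 - (Q - 1) * s by rewrite subr_gt0.
have {le} := gt0_ler_poweR (ltW q10) _ _ le.
rewrite !in_itv/= avg0 leey/= lee_fin divr_ge0 ?powR_ge0 ?(ltW D0)//= leey.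
move=> /(_ isT isT) le.
apply: (@le_trans _ _ (A%:E * ((A * Q) `^ (- s) / (1 - (Q - 1) * s))%:E
  `^ (q - 1))%E); first by apply: lee_wpmul2l le; rewrite lee_fin ltW.
rewrite poweR_EFin -EFinM lee_fin.
have -> : (q - 1) / (q - Q) = (1 - (Q - 1) * s)^-1.
  rewrite /s; field; lra.
rewrite powRM ?powR_ge0 ?invr_ge0 ?(ltW D0)// -powRrM.
rewrite (_ : - s * (q - 1) = -1); last by rewrite /s mulNr mulVf// gt_eqF.
by rewrite powR_inv1 ?(ltW AQ0)// mulrA invfM mulVKf ?gt_eqF.
Qed.

End upper_bounds.

Section Ainfty_upper_bound.
Context {R : realType}.
Local Notation mu := (@lebesgue_measure R).
Implicit Types (p delta q Q s : R) (I J : set R) (w : R -> R).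

Lemma le_integral_measurable d (T : measurableType d)
    (m : {measure set T -> \bar R}) (D : set T) (f g : T -> \bar R) :
  measurable D -> measurable_fun D f -> measurable_fun D g ->
  (forall x, D x -> (f x <= g x)%E) ->
  (\int[m]_(x in D) f x <= \int[m]_(x in D) g x)%E.
Proof.
move=> mD mf mg fg; rewrite integralE [leRHS]integralE; apply: leeB.
  apply: ge0_le_integral => //; try exact: measurable_funepos.
  by move=> x Dx; rewrite !funeposE; apply: le_max2 => //; exact: fg.
apply: ge0_le_integral => //; try exact: measurable_funeneg.
by move=> x Dx; rewrite !funenegE; apply: le_max2 => //; rewrite leeN2 fg.
Qed.

(** This is ln y <= y - 1 at y = x^(-s) / K, the tangent form of Jensen's inequality. With [K] a
    bound for the mean of x^(-s), averaging gives - ln K / s. At x = 0 both sides are -oo. *)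
Lemma lne_ge_epow s (K x : R) : 0 < s -> 0 < K -> 0 <= x ->
  ((- ((ln K - 1) / s))%:E - (s * K)^-1%:E * epow x (- s)%R <= lne x%:E)%E.
Proof.
move=> s0 K0; have sK0 : 0 < s * K by rewrite mulr_gt0.
rewrite le_eqVlt => /predU1P[<-|x0].
  by rewrite /epow eqxx oppr_lt0 s0/= gt0_muley ?lte_fin ?invr_gt0//= addeNy leNye.
have -> : epow x (- s) = (x `^ (- s))%:E by rewrite /epow gt_eqF.
rewrite lne_EFin// -EFinM -EFinB lee_fin.
have y0 : 0 < x `^ (- s) / K by rewrite divr_gt0// powR_gt0.
have := @le_ln1Dx R (x `^ (- s) / K - 1).
rewrite ltrBrDl subrr => /(_ y0); rewrite addrC subrK.
rewrite ln_div ?posrE ?powR_gt0// ln_powR => h.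
rewrite -(ler_pM2l s0) mulrBr mulrN (mulrC s (_ / s)) divfK ?gt_eqF//.
have -> : s * ((s * K)^-1 * x `^ (- s)) = x `^ (- s) / K.
  by field; rewrite !gt_eqF.
by move: h; set u := _ / K; lra.
Qed.

Lemma expR_avg_lne_le p delta Q s J w :
  1 < p -> 1 <= delta -> tangent_data p (delta `^ p) Q ->
  0 < s -> (Q - 1) * s < 1 ->
  bounded_interval J -> reverse_holder p delta J w ->
  (average (EFin \o w) J *
    expeR (- average (fun t => lne (w t)%:E) J) <=
    (Q^-1 * expR ((Q - 1) / (1 - (Q - 1) * s)))%:E)%E.
Proof.
move=> p1 d1 tD s0 sQ bJ RH.
have [l [r [v [A [[lr A0] v0 [vi vpi] [vA RHv] [wA avgE]]]]]] :=
  reverse_holder_borel p1 d1 bJ RH.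
have [_ _ Q1 _] := tD.
have mom := negative_moment tD s0 sQ lr A0 v0 vi vpi vA RHv.
have D0 : 0 < 1 - (Q - 1) * s by rewrite subr_gt0.
have AQ0 : 0 < A * Q by rewrite mulr_gt0//; lra.
have rl0 : 0 < r - l by rewrite subr_gt0.
set K := (A * Q) `^ (- s) / (1 - (Q - 1) * s) in mom.
have K0 : 0 < K by rewrite divr_gt0// powR_gt0.
rewrite wA (avgE (fun c : R => lne c%:E) measurable_lne_EFin).
have mv : @measurable_fun _ _ (measurableTypeR R) (measurableTypeR R) setT v.
  by have /measurable_EFinP := measurable_int mu vi.
have mI := measurable_itv `]l, r[.
have mphiv (phi : R -> \bar R) : measurable_fun setT phi ->
    @measurable_fun _ _ (measurableTypeR R) _ `]l, r[ (phi \o v).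
  move=> mphi; apply: measurable_funTS.
  by apply: (@measurable_comp _ _ _ (measurableTypeR R) (measurableTypeR R)) mphi mv.
pose e t := epow (v t) (- s).
have me : @measurable_fun _ _ (measurableTypeR R) _ `]l, r[ e.
  exact: (mphiv _ (measurable_epow (- s))).
have e0 t : (0 <= e t)%E.
  by rewrite /e /epow; case: ifP => _; rewrite ?leey// lee_fin powR_ge0.
have ei : mu.-integrable `]l, r[ e.
  apply/integrableP; split => //.
  under eq_integral do rewrite gee0_abs//.
  by apply: le_lt_trans mom _; rewrite ltry.
pose c0 := - ((ln K - 1) / s).
have lower : ((c0 * (r - l) - (s * K)^-1 * ((r - l) * K))%:E <=
    \int[mu]_(t in `]l, r[) lne (v t)%:E)%E.
  apply: (@le_trans _ _ (\int[mu]_(t in `]l, r[)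
      (c0%:E - (s * K)^-1%:E * e t))%E); last first.
    apply: le_integral_measurable => //.
    - apply: emeasurable_funB => //; exact: measurable_funeM.
    - exact: (mphiv _ measurable_lne_EFin).
    - by move=> t _; apply: lne_ge_epow.
  rewrite integralB//; last 2 first.
  - exact: integrable_cst_oo.
  - exact: integrableZl.
  rewrite integral_cst// integralZl//.
  rewrite /= lebesgue_measure_itv/= lte_fin lr -EFinB -EFinM EFinB EFinM.
  apply: leeB => //; rewrite EFinM; apply: lee_wpmul2l => //.
  by rewrite lee_fin invr_ge0 ltW// mulr_gt0.
have : (- (\int[mu]_(t in `]l, r[) lne (v t)%:E * (r - l)^-1%:E) <=
    (ln K / s)%:E)%E.
  rewrite leeNl -EFinN lee_pdivlMr//; apply: le_trans lower.
  rewrite -EFinM lee_fin /c0 invfM.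
  have -> : s^-1 * K^-1 * ((r - l) * K) = (r - l) / s.
    by field; rewrite !gt_eqF.
  lra.
move=> le; rewrite -lee_expeR in le.
apply: (@le_trans _ _ (A%:E * expeR (ln K / s)%:E)%E).
  by apply: lee_wpmul2l le; rewrite lee_fin ltW.
rewrite /= lee_fin.
have -> : ln K / s = - ln (A * Q) + (- ln (1 - (Q - 1) * s)) / s.
  rewrite /K ln_div ?posrE ?powR_gt0// ln_powR; field.
  by rewrite gt_eqF.
rewrite expRD expRN lnK ?posrE// invfM mulrA mulrA divff ?gt_eqF// mul1r.
rewrite ler_pM2l ?invr_gt0; last lra.
rewrite ler_expR ler_pdivrMr// mulrAC.
(* With u = (Q - 1) s, ln (1 / (1 - u)) <= u / (1 - u); this trades the logarithm for a bound whose
   limit Q - 1 as s tends to 0 is visible. *)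
have := @le_ln1Dx R ((1 - (Q - 1) * s)^-1 - 1).
rewrite ltrBrDl subrr invr_gt0 => /(_ D0); rewrite [1 + (_ - 1)]addrC subrK.
rewrite lnV ?posrE// => /le_trans; apply.
have -> // : (1 - (Q - 1) * s)^-1 - 1 = (Q - 1) * s / (1 - (Q - 1) * s).
by field; rewrite gt_eqF.
Qed.

Lemma Ainfty_constant_le p delta I w : 1 < p -> 1 <= delta ->
  bounded_interval I -> reverse_holder p delta I w ->
  (Ainfty_constant I w <= Cinfty p delta)%E.
Proof.
move=> p1 d1 bI RH; rewrite /Cinfty /=.
have tD := critical_exponent_tangent p1 d1.
move: (critical_exponent p delta) tD => Q tD.
have [_ _ Q1 _] := tD.
apply: ge_ereal_sup => _ [J sJ <-].
have RHJ := reverse_holderS bI sJ RH.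
set M := Q^-1 * expR (Q - 1).
have M0 : 0 < M by rewrite mulr_gt0 ?expR_gt0 ?invr_gt0//; lra.
apply/lee_addgt0Pr => e e0.
(* [eta] is the slack that [e] leaves in the exponent: M + e = exp (Q - 1 + eta) / Q. The goal (Q -
   1) / (1 - (Q - 1) s) <= Q - 1 + eta then reads (Q - 1) s (Q - 1 + eta) <= eta, and [den] is
   chosen to give it, its last summands keeping it positive when Q = 1. *)
pose eta := ln (1 + e / M).
have eM0 : 0 < e / M by rewrite divr_gt0.
have eta0 : 0 < eta by rewrite ln_gt0// ltrDl.
pose den := (Q - 1) * (Q - 1 + eta) + eta + 1.
have den1 : 0 <= (Q - 1) * (Q - 1 + eta) by rewrite mulr_ge0//; lra.
have den0 : 0 < den by rewrite /den; lra.
pose s := eta / den.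
have s0 : 0 < s by rewrite divr_gt0.
have sd : s * den = eta by rewrite /s divfK// gt_eqF.
have sle : (Q - 1) * s * (Q - 1 + eta) <= eta.
  rewrite -{2}sd; have : 0 <= s * (eta + 1) by rewrite mulr_ge0//; lra.
  by rewrite /den; lra.
have sQ : (Q - 1) * s < 1.
  rewrite ltNge; apply/negP => sQ.
  have a0 : 0 < Q - 1.
    by rewrite lt_neqAle subr_ge0 Q1 andbT; apply: contraTneq sQ => <-;
      rewrite mul0r -ltNge ltr01.
  have : 0 <= ((Q - 1) * s - 1) * (Q - 1 + eta).
    by rewrite mulr_ge0// ?subr_ge0//; lra.
  by move: sle a0; clear; lra.
apply: le_trans (expR_avg_lne_le p1 d1 tD s0 sQ sJ.1 RHJ) _.
rewrite -EFinD lee_fin.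
have -> : M + e = Q^-1 * expR (Q - 1 + eta).
  rewrite expRD /eta lnK; last by rewrite posrE; lra.
  by rewrite mulrA -/M mulrDr mulr1 mulrCA divff ?mulr1// gt_eqF.
rewrite ler_pM2l ?invr_gt0; last lra.
rewrite ler_expR ler_pdivrMr ?subr_gt0//.
by move: sle; clear; lra.
Qed.

End Ainfty_upper_bound.

(** * Sharpness: power weights *)

Section power_integrals.
Context {R : realType}.
Local Notation mu := (@lebesgue_measure R).
Implicit Types (a b c d l r x y : R).

Lemma measurable_shifted_powR l b :
  @measurable_fun _ _ (measurableTypeR R) (measurableTypeR R) setT
    (fun t : R => (t - l) `^ b).
Proof.
apply: (measurableT_comp (@measurable_powR R b)).
by apply: measurable_funB.
Qed.

Lemma is_derive_shifted_powR l b x : l < x ->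
  is_derive x 1 (fun t : R => (t - l) `^ b) (b * (x - l) `^ (b - 1)).
Proof.
move=> lx; have xl : 0 < x - l by rewrite subr_gt0.
have dg : is_derive x 1 (fun t : R => t - l) 1.
  by apply: is_derive_eq; rewrite subr0.
have df := is_derive1_powR b xl.
have := @is_derive1_comp R (fun t => t `^ b) (fun t => t - l) x _ _ df dg.
by rewrite mulr1.
Qed.

Lemma integral_shifted_powR_pos l b c d : 0 < b -> l < c -> c <= d ->
  (\int[mu]_(t in `]c, d[) ((t - l) `^ (b - 1))%:E =
   (((d - l) `^ b - (c - l) `^ b) / b)%:E)%E.
Proof.
move=> b0 lc; rewrite le_eqVlt => /predU1P[->|cd].
  by rewrite set_itvoo0 integral_set0 subrr mul0r.
pose F t : R := b^-1 * (t - l) `^ b.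
have dF x : l < x -> is_derive x 1 F ((x - l) `^ (b - 1)).
  move=> lx; have := is_derive_shifted_powR b lx => H.
  rewrite /F; apply: is_derive_eq; rewrite /GRing.scale/=.
  by field; rewrite gt_eqF.
have cF x : l < x -> {for x, continuous F}.
  move=> lx; apply: differentiable_continuous; apply/derivable1_diffP.
  by apply: ex_derive; exact: dF.
rewrite -(@integral_itv_bndoo R c d _ true false); last first.
  by apply/measurable_EFinP/measurable_funTS; exact: measurable_shifted_powR.
rewrite (@continuous_FTC2 R (fun t => (t - l) `^ (b - 1)) F c d cd).
- by rewrite -EFinB /F; congr (_%:E); rewrite -mulrBr mulrC.
- apply: derivable_within_continuous => x; rewrite in_itv/= => /andP[cx _].
  by apply: ex_derive; apply: is_derive_shifted_powR; lra.
- split.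
  + move=> x; rewrite in_itv/= => /andP[cx _].
    by apply: ex_derive; apply: dF; lra.
  + by apply: cvg_at_right_filter; exact: cF.
  + by apply: cvg_at_left_filter; apply: cF; lra.
- move=> x; rewrite in_itv/= => /andP[cx _].
  have lx : l < x by lra.
  by rewrite derive1E; have H := dF x lx; exact: derive_val.
Qed.

(** For b < 1 the integrand is unbounded near [l], so the fundamental theorem is applied on
    intervals starting at [c n], and [c n] decreases to [l]. *)
Lemma integral_shifted_powR_left l b d : 0 < b -> l <= d ->
  (\int[mu]_(t in `]l, d[) ((t - l) `^ (b - 1))%:E =
   ((d - l) `^ b / b)%:E)%E.
Proof.
move=> b0; rewrite le_eqVlt => /predU1P[->|ld].
  by rewrite set_itvoo0 integral_set0 subrr powR0 ?gt_eqF// mul0r.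
have dl0 : 0 < d - l by rewrite subr_gt0.
pose c n : R := l + (d - l) * expR (- n.+1%:R).
have e1 n : expR (- n.+1%:R) < 1 :> R.
  by rewrite -expR0 ltr_expR oppr_lt0.
have lc n : l < c n by rewrite ltrDl mulr_gt0// expR_gt0.
have cd n : c n < d.
  by rewrite /c -ltrBrDl -[ltRHS]mulr1 ltr_pM2l.
pose f t := ((t - l) `^ (b - 1))%:E.
have mf : @measurable_fun _ _ (measurableTypeR R) _ setT f.
  by apply/measurable_EFinP; exact: measurable_shifted_powR.
have UE : \bigcup_n `]c n, d[%classic = `]l, d[%classic.
  apply/seteqP; split => [t [n _]|t] /=; rewrite !in_itv/= => /andP[ct td].
    by rewrite td (lt_trans (lc n)).
  have tl : 0 < (t - l) / (d - l) by rewrite divr_gt0// subr_gt0.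
  pose n := Num.truncn (- ln ((t - l) / (d - l))).
  exists n => //=; rewrite in_itv/= td andbT /c -ltrBrDl mulrC -ltr_pdivlMr//.
  rewrite -[ltRHS](@lnK R) ?posrE// ltr_expR ltrNl.
  exact: truncnS_gt.
have cvg1 : (\int[mu]_(t in `]c n, d[) f t)%E @[n --> \oo] -->
    (\int[mu]_(t in `]l, d[) f t)%E.
  rewrite -UE; apply: ge0_nondecreasing_set_cvg_integral.
  - move=> n m nm; rewrite subsetEset => t /=; rewrite !in_itv/= => /andP[ct ->].
    rewrite andbT; apply: le_lt_trans ct; rewrite /c lerD2l ler_pM2l// ler_expR.
    by rewrite lerN2 ler_nat ltnS.
  - by move=> n; exact: measurable_itv.
  - by move=> n; exact: measurable_funTS.
  - by move=> n t _; rewrite lee_fin powR_ge0.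
have cvg2 : (\int[mu]_(t in `]c n, d[) f t)%E @[n --> \oo] -->
    ((d - l) `^ b / b)%:E.
  have -> : (fun n => \int[mu]_(t in `]c n, d[) f t)%E =
      EFin \o (fun n => (d - l) `^ b / b - (d - l) `^ b / b * expR (- (b * n.+1%:R))).
    apply/funext => n; rewrite /= integral_shifted_powR_pos ?(ltW (cd n))//.
    have -> : c n - l = (d - l) * expR (- n.+1%:R) by rewrite /c addrAC subrr add0r.
    congr (_%:E); rewrite powRM ?expR_ge0 ?(ltW dl0)//.
    by rewrite -expRM mulNr (mulrC b); lra.
  apply: cvg_EFin; first by apply: nearW.
  rewrite -[X in _ --> X]subr0 -[X in _ --> _ - X](mulr0 ((d - l) `^ b / b)).
  apply: cvgB; first exact: cvg_cst.
  apply: cvgMr; under eq_fun do rewrite mulrC -mulrN expRM_natl.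
  have : GRing.exp (expR (- b)) @ \oo --> (0 : R).
    apply: cvg_expr; rewrite ger0_norm ?expR_ge0//.
    by rewrite -expR0 ltr_expR oppr_lt0.
  by rewrite -cvg_shiftS.
by rewrite -(cvg_lim _ cvg1)//; exact: cvg_lim cvg2.
Qed.

Lemma integral_shifted_powR l b c d : 1 <= b -> l <= c -> c < d ->
  (\int[mu]_(t in `]c, d[) ((t - l) `^ (b - 1))%:E =
   (((d - l) `^ b - (c - l) `^ b) / b)%:E)%E.
Proof.
move=> b1; have b0 : 0 < b by lra.
rewrite le_eqVlt => /predU1P[<-|lc] cd; last first.
  by rewrite integral_shifted_powR_pos// ltW.
by rewrite integral_shifted_powR_left ?(ltW cd)// subrr powR0 ?gt_eqF// subr0.
Qed.

Lemma integral_shifted_powR_pinfty l b d : b <= 0 -> l < d ->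
  (\int[mu]_(t in `]l, d[) ((t - l) `^ (b - 1))%:E = +oo)%E.
Proof.
move=> b0 ld; have dl0 : 0 < d - l by rewrite subr_gt0.
apply/eqyP => M M0.
(* The power b' - 1 > -1 is integrable and, rescaled to agree at [d], lies below the given one; this
   [b'] makes its integral exactly [M]. *)
pose b' := (d - l) `^ b / M.
have b'0 : 0 < b' by rewrite divr_gt0// powR_gt0.
have f_ge t : l < t < d ->
    (d - l) `^ (b - b') * (t - l) `^ (b' - 1) <= (t - l) `^ (b - 1).
  move=> /andP[lt td].
  have [u u01 ->] : exists2 u, 0 < u <= 1 & t - l = (d - l) * u.
    exists ((t - l) / (d - l)); last by rewrite mulrC divfK// gt_eqF.
    rewrite divr_gt0 ?subr_gt0//= ler_pdivrMr// mul1r; lra.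
  have [u0 _] := andP u01.
  rewrite !powRM ?(ltW dl0) ?(ltW u0)// mulrA -powRD; last first.
    by rewrite (gt_eqF dl0) implybT.
  rewrite addrA subrK ler_wpM2l ?powR_ge0//.
  by apply: ger_powR => //; lra.
have mb (c : R) : @measurable_fun _ _ (measurableTypeR R) _ `]l, d[
    (fun t : R => ((t - l) `^ c)%:E).
  by apply/measurable_EFinP/measurable_funTS; exact: measurable_shifted_powR.
apply: (@le_trans _ _ (\int[mu]_(t in `]l, d[)
    (((d - l) `^ (b - b'))%:E * ((t - l) `^ (b' - 1))%:E))%E); last first.
  apply: ge0_le_integral => //.
  - by move=> t _; rewrite mule_ge0// lee_fin powR_ge0.
  - exact: measurable_funeM.
rewrite ge0_integralZl ?lee_fin ?powR_ge0//; last first.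
  by move=> t _; rewrite lee_fin powR_ge0.
rewrite integral_shifted_powR_left ?(ltW ld)// -EFinM lee_fin.
rewrite mulrA -powRD; last by rewrite (gt_eqF dl0) implybT.
rewrite subrK /b' invf_div mulrCA divff ?mulr1//.
by rewrite gt_eqF// powR_gt0.
Qed.

End power_integrals.

Section sharpness.
Context {R : realType}.
Local Notation mu := (@lebesgue_measure R).
Implicit Types (p delta q Q m D s c d l r : R) (I J : set R).

(** Hoelder's inequality for two summands, d^m = (d^m - c^m) + c^m and d = (d - c) + c, with
    exponents p and p / (p - 1). The products of powers of [c] and of [d] collapse to c^Q and d^Q
    because m / p + (p - 1) / p = Q. *)
Lemma powR_sub_hoelder p Q c d : 1 < p -> 1 <= Q -> 0 <= c -> c < d ->
  (d `^ (p * Q - p + 1) - c `^ (p * Q - p + 1)) * (d - c) `^ (p - 1) <=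
  (d `^ Q - c `^ Q) `^ p.
Proof.
move=> p1 Q1 c0 cd; set m := p * Q - p + 1.
have p0 : 0 < p by lra.
have d0 : 0 <= d by lra.
have m1 : 1 <= m.
  have : 0 <= p * (Q - 1) by rewrite mulr_ge0; lra.
  by rewrite /m; lra.
have homo e : 0 <= e -> c `^ e <= d `^ e.
  by move=> e0; apply: ge0_ler_powR => //; rewrite ?nnegrE// ltW.
have dm0 : 0 <= d `^ m - c `^ m by rewrite subr_ge0 homo//; lra.
have dc0 : 0 <= d - c by lra.
pose p' := p / (p - 1).
have p'0 : 0 < p' by rewrite divr_gt0//; lra.
pose k := (p - 1) / p.
have kp' : k * p' = 1 by rewrite /k /p'; field; rewrite !gt_eqF//; lra.
have := @hoelder2 R ((d `^ m - c `^ m) `^ p^-1) ((c `^ m) `^ p^-1)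
  ((d - c) `^ k) (c `^ k) p p' (powR_ge0 _ _) (powR_ge0 _ _) (powR_ge0 _ _)
  (powR_ge0 _ _) p0 p'0.
have -> : p^-1 + p'^-1 = 1 by rewrite /p'; field; rewrite !gt_eqF//; lra.
move=> /(_ erefl).
have e1 (x : R) : 0 <= x -> x `^ p^-1 `^ p = x.
  by move=> x0; rewrite -powRrM mulVf ?gt_eqF// powRr1.
have e2 (x : R) : 0 <= x -> x `^ k `^ p' = x.
  by move=> x0; rewrite -powRrM kp' powRr1.
rewrite (e1 _ dm0) (e1 _ (powR_ge0 _ _)) (e2 _ dc0) (e2 _ c0) !subrK -!powRrM.
have p'V : p'^-1 = k by rewrite /p' /k invf_div.
have Q0 : m * p^-1 + k = Q by rewrite /m /k; field; rewrite gt_eqF.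
have D0 (x : R) : x `^ (m * p^-1) * x `^ k = x `^ Q.
  by rewrite -powRD Q0// gt_eqF//; lra.
rewrite p'V !D0 => h.
have {}h : (d `^ m - c `^ m) `^ p^-1 * (d - c) `^ k <= d `^ Q - c `^ Q by lra.
have := @ge0_ler_powR R p (ltW p0) _ _ _ _ h.
rewrite !nnegrE mulr_ge0 ?powR_ge0// subr_ge0 homo; last lra.
move=> /(_ isT isT); rewrite powRM ?powR_ge0// -!powRrM mulVf ?gt_eqF//.
by rewrite powRr1// /k divfK ?gt_eqF.
Qed.

(** The equation for [Q] says D / Q^p = 1 / (p Q - p + 1), which matches the constants of the two
    integrals and leaves [powR_sub_hoelder]. *)
Lemma powR_average_reverse_holder p D Q c d : tangent_data p D Q ->
  0 <= c -> c < d ->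
  (d `^ (p * Q - p + 1) - c `^ (p * Q - p + 1)) / (p * Q - p + 1) / (d - c) <=
  D * ((d `^ Q - c `^ Q) / Q / (d - c)) `^ p.
Proof.
move=> [p1 D1 Q1 QE] c0 cd; set m := p * Q - p + 1.
have p0 : 0 < p by lra.
have m1 : 1 <= m.
  have : 0 <= p * (Q - 1) by rewrite mulr_ge0; lra.
  by rewrite /m; lra.
have h0 : 0 < d - c by rewrite subr_gt0.
have Q0 : 0 < Q by lra.
have dc : 0 <= d `^ Q - c `^ Q.
  by rewrite subr_ge0 ge0_ler_powR// ?nnegrE; lra.
have := powR_sub_hoelder p1 Q1 c0 cd; rewrite -/m => h.
have -> : (d `^ Q - c `^ Q) / Q / (d - c) = (d `^ Q - c `^ Q) / (Q * (d - c)).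
  by rewrite invfM mulrA.
rewrite powR_div ?mulr_gt0// powRN powRM ?(ltW h0) ?(ltW Q0)// QE -/m.
have -> : (d - c) `^ p = (d - c) * (d - c) `^ (p - 1).
  by rewrite mulr_powRB1// ltW.
have hp0 : 0 < (d - c) `^ (p - 1) by rewrite powR_gt0.
have -> : D * ((D * m * ((d - c) * (d - c) `^ (p - 1)))^-1 *
    (d `^ Q - c `^ Q) `^ p) =
  (d `^ Q - c `^ Q) `^ p / (d - c) `^ (p - 1) / m / (d - c).
  by field; rewrite !gt_eqF//; lra.
rewrite ler_pM2r ?invr_gt0// ler_pM2r ?invr_gt0; last lra.
by rewrite ler_pdivlMr.
Qed.

Lemma itv_sub_left a b c d a' b' l r : c < d ->
  [set` Interval (BSide a c) (BSide b d)] `<=`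
  [set` Interval (BSide a' l) (BSide b' r)] -> l <= c.
Proof.
move=> cd sub; rewrite leNgt; apply/negP => cl.
pose t := Num.min ((c + l) / 2) ((c + d) / 2).
have ct : c < t by rewrite lt_min; apply/andP; split; lra.
have td : t < d by rewrite gt_min; apply/orP; right; lra.
have tl : t < l by rewrite gt_min; apply/orP; left; lra.
have /sub : [set` Interval (BSide a c) (BSide b d)] t.
  by move: ct td; clear; case: a; case: b; rewrite /= in_itv/= => ct td;
    apply/andP; split; lra.
by move: tl; clear; case: a'; case: b'; rewrite /= in_itv/= => tl /andP[lt _];
  lra.
Qed.

Lemma powR_epow l s Q (t : R) : l < t ->
  epow ((t - l) `^ (Q - 1)) s = ((t - l) `^ ((Q - 1) * s))%:E.
Proof.
move=> lt; rewrite /epow gt_eqF/= ?powR_gt0 ?subr_gt0//.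
by rewrite -powRrM.
Qed.

Lemma measurable_powR_weight l Q :
  @measurable_fun _ _ (measurableTypeR R) _ setT
    (EFin \o (fun t : R => (t - l) `^ (Q - 1))).
Proof. by apply/measurable_EFinP; exact: measurable_shifted_powR. Qed.

Lemma measurable_epow_powR_weight l Q s :
  @measurable_fun _ _ (measurableTypeR R) _ setT
    (fun t : R => epow ((t - l) `^ (Q - 1)) s).
Proof.
exact: (@measurable_comp _ _ _ (measurableTypeR R) (measurableTypeR R) _ setT
  (fun c : R => epow c s)) (measurable_epow s) (measurable_shifted_powR _ _).
Qed.

Lemma average_powR_weight a b c d l Q : 1 <= Q -> l <= c -> c < d ->
  average (EFin \o (fun t => (t - l) `^ (Q - 1)))
    [set` Interval (BSide a c) (BSide b d)] =
  (((d - l) `^ Q - (c - l) `^ Q) / Q / (d - c))%:E.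
Proof.
move=> Q1 lc cd; rewrite averageE//; last exact: measurable_powR_weight.
by rewrite integral_shifted_powR// -EFinM.
Qed.

Lemma average_epow_powR_weight a b l r Q s : l < r -> 0 < (Q - 1) * s + 1 ->
  average (fun t => epow ((t - l) `^ (Q - 1)) s)
    [set` Interval (BSide a l) (BSide b r)] =
  ((r - l) `^ ((Q - 1) * s) / ((Q - 1) * s + 1))%:E.
Proof.
move=> lr sQ; rewrite averageE//; last exact: measurable_epow_powR_weight.
have rl0 : 0 < r - l by rewrite subr_gt0.
under eq_integral => t.
  rewrite inE/= in_itv/= => /andP[lt _]; rewrite powR_epow//.
  rewrite -[X in _ `^ X](addrK 1); over.
rewrite integral_shifted_powR_left ?(ltW lr)// -EFinM; congr (_%:E).
rewrite powRD; last by rewrite (gt_eqF rl0) implybT.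
by rewrite powRr1 ?(ltW rl0)//; field; rewrite !gt_eqF.
Qed.

Lemma reverse_holder_powR_weight p delta Q a b l r :
  tangent_data p (delta `^ p) Q -> 1 <= delta -> l < r ->
  reverse_holder p delta [set` Interval (BSide a l) (BSide b r)]
    (fun t => (t - l) `^ (Q - 1)).
Proof.
move=> tD d1 lr; have [p1 D1 Q1 QE] := tD.
have p0 : 0 < p by lra.
split.
  split; last by move=> t _; exact: powR_ge0.
  apply: measurable_funTS.
  apply: (@measurable_comp _ _ _ (lebesgue_line R) (measurableTypeR R)
    (measurableTypeR R) setT (fun t : R => (t - l) `^ (Q - 1))) => //.
    exact: measurable_shifted_powR.
  exact: measurable_idfun_lebesgue_borel.
move=> J [bJ JI].
have [a' [b' [c [d [cd JE]]]]] := bounded_interval_itv bJ.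
rewrite JE in JI *; have lc := itv_sub_left cd JI.
rewrite average_powR_weight//.
set m := p * Q - p + 1.
have m1 : 1 <= m.
  have : 0 <= p * (Q - 1) by rewrite mulr_ge0; lra.
  by rewrite /m; lra.
have -> : average (fun t => epow ((t - l) `^ (Q - 1)) p)
    [set` Interval (BSide a' c) (BSide b' d)] =
    (((d - l) `^ m - (c - l) `^ m) / m / (d - c))%:E.
  rewrite averageE//; last exact: measurable_epow_powR_weight.
  under eq_integral => t.
    rewrite inE/= in_itv/= => /andP[ct _]; rewrite powR_epow; last lra.
    rewrite (_ : (Q - 1) * p = m - 1); last by rewrite /m; lra.
    over.
  by rewrite integral_shifted_powR// -EFinM.
have c0 : 0 <= c - l by rewrite subr_ge0.
have cld : c - l < d - l by lra.
have dcE : d - l - (c - l) = d - c by lra.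
have := powR_average_reverse_holder tD c0 cld; rewrite -/m dcE.
set X := (_ - _) / m / _; set Y := (_ - _) / Q / _ => XY.
have Y0 : 0 < Y.
  rewrite !divr_gt0 ?subr_gt0//; last lra.
  by apply: gt0_ltr_powR; rewrite ?nnegrE//; lra.
have X0 : 0 <= X.
  rewrite !divr_ge0 ?subr_ge0 ?(ltW cd)//; last lra.
  by apply: ge0_ler_powR; rewrite ?nnegrE//; lra.
split; first by rewrite lte_fin Y0 ltry.
rewrite poweR_EFin inver gt_eqF// -EFinM lee_fin ler_pdivrMr//.
have dY0 : 0 <= delta * Y by rewrite mulr_ge0// ?(ltW Y0)//; lra.
have := @ge0_ler_powR R p^-1 _ X (delta `^ p * Y `^ p) _ _ XY.
rewrite !nnegrE invr_ge0 (ltW p0) X0 mulr_ge0 ?powR_ge0// => /(_ isT isT isT).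
rewrite -powRM ?(ltW Y0)//; last lra.
by rewrite -powRrM divff ?gt_eqF// powRr1.
Qed.

(** One weight and the single interval J = I are enough: for the power weight at the left end of [I]
    the product of averages over [I] equals [Cq]. *)
Lemma Cq_le p delta q I (C : \bar R) : 1 < p -> 1 <= delta ->
  bounded_interval I -> 1 < q ->
  (forall w, reverse_holder p delta I w -> (Aq_constant I q w <= C)%E) ->
  (Cq p delta q <= C)%E.
Proof.
move=> p1 d1 bI q1 HC.
have tD := critical_exponent_tangent p1 d1.
have [a [b [l [r [lr IE]]]]] := bounded_interval_itv bI.
rewrite /Cq /=; move: (critical_exponent p delta) tD => Q tD.
have [_ _ Q1 _] := tD.
have RH : reverse_holder p delta I (fun t => (t - l) `^ (Q - 1)).
  by rewrite IE; exact: reverse_holder_powR_weight.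
apply: le_trans (HC _ RH).
apply: (@le_trans _ _ (average (EFin \o (fun t => (t - l) `^ (Q - 1))%R) I *
  average (fun t => epow ((t - l) `^ (Q - 1)) (1 - conjugate_exponent q)%R) I
    `^ (q - 1))%E); last first.
  by apply: ereal_sup_ubound; exists I => //; split.
rewrite IE average_powR_weight// subrr powR0 ?subr0; last by rewrite gt_eqF//; lra.
have rl0 : 0 < r - l by rewrite subr_gt0.
have Q0 : 0 < Q by lra.
have q10 : 0 < q - 1 by rewrite subr_gt0.
have A0 : 0 < (r - l) `^ Q / Q / (r - l) by rewrite !divr_gt0// powR_gt0.
have cE : 1 - conjugate_exponent q = - (q - 1)^-1.
  by rewrite /conjugate_exponent; field; rewrite gt_eqF.
case: (leP q) => [qQ|Qq].
  (* Here the exponent of t - l is - (Q - 1) / (q - 1) <= -1, and the integral diverges. *)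
  rewrite averageE//; last exact: measurable_epow_powR_weight.
  under eq_integral => t.
    rewrite inE/= in_itv/= => /andP[lt _]; rewrite powR_epow//.
    rewrite -[X in _ `^ X](addrK 1); over.
  rewrite integral_shifted_powR_pinfty//; last first.
    rewrite cE mulrN addrC subr_le0 ler_pdivlMr// mul1r; lra.
  rewrite gt0_mulye ?lte_fin ?invr_gt0// poweRyr ?gt_eqF//.
  by rewrite gt0_muley// lte_fin.
have sQ : 0 < (Q - 1) * (1 - conjugate_exponent q) + 1.
  by rewrite cE mulrN addrC subr_gt0 ltr_pdivrMr// mul1r; lra.
rewrite average_epow_powR_weight// poweR_EFin -EFinM lee_fin.
rewrite cE in sQ *.
have E0 : 0 <= ((Q - 1) * - (q - 1)^-1 + 1)^-1 by rewrite invr_ge0 ltW.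
rewrite [in leRHS]powRM ?powR_ge0// -powRrM.
have -> : (Q - 1) * - (q - 1)^-1 * (q - 1) = - (Q - 1).
  by rewrite mulrN mulNr divfK// gt_eqF.
have -> : ((Q - 1) * - (q - 1)^-1 + 1)^-1 = (q - 1) / (q - Q).
  by field; rewrite !gt_eqF//; lra.
rewrite powRN mulrA.
have -> : (r - l) `^ Q = (r - l) * (r - l) `^ (Q - 1).
  by rewrite mulr_powRB1// ltW.
rewrite le_eqVlt; apply/orP; left; apply/eqP.
by field; rewrite !gt_eqF// ?powR_gt0//; lra.
Qed.

End sharpness.

Section sharpness_infty.
Context {R : realType}.
Local Notation mu := (@lebesgue_measure R).
Implicit Types (p delta Q s l r : R) (I : set R).

(** A bound through powers replaces integration of the logarithm: with u = (t - l) / (r - l) and e =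
    (Q - 1) s, s (Q - 1) ln u <= u^e - 1, and the mean of u^e is 1 / (e + 1). The bound tends to the
    true mean as s tends to 0. *)
Lemma average_lne_powR_weight_le a b l r Q s : l < r -> 1 <= Q -> 0 < s ->
  (average (fun t => lne ((t - l) `^ (Q - 1))%:E)
    [set` Interval (BSide a l) (BSide b r)] <=
  ((Q - 1) * ln (r - l) - (Q - 1) / (1 + (Q - 1) * s))%:E)%E.
Proof.
move=> lr Q1 s0.
have rl0 : 0 < r - l by rewrite subr_gt0.
set e := (Q - 1) * s.
have e0 : 0 <= e by rewrite mulr_ge0//; lra.
have mlne : @measurable_fun _ _ (measurableTypeR R) _ setT
    (fun t : R => lne ((t - l) `^ (Q - 1))%:E).
  exact: (@measurable_comp _ _ _ (measurableTypeR R) (measurableTypeR R) _ setT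
    (fun c : R => lne c%:E)) measurable_lne_EFin (measurable_shifted_powR _ _).
rewrite averageE// lee_pdivrMr// -EFinM.
pose f (t : R) := (t - l) `^ e.
have mf : @measurable_fun _ _ (measurableTypeR R) (measurableTypeR R) `]l, r[ f.
  by apply: measurable_funTS; exact: measurable_shifted_powR.
have fE : (\int[mu]_(t in `]l, r[) (f t)%:E =
    ((r - l) `^ (e + 1) / (e + 1))%:E)%E.
  rewrite -integral_shifted_powR_left ?(ltW lr)//; last lra.
  by apply: eq_integral => t _; rewrite /f addrK.
have fi : mu.-integrable `]l, r[ (EFin \o f).
  apply/integrableP; split; first exact/measurable_EFinP.
  under eq_integral do rewrite gee0_abs ?lee_fin ?powR_ge0//.
  by rewrite fE ltry.
pose k1 := (Q - 1) * ln (r - l) - s^-1.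
pose k2 := (r - l) `^ (- e) / s.
have mI := measurable_itv `]l, r[.
apply: (@le_trans _ _ (\int[mu]_(t in `]l, r[)
    ((EFin \o cst k1) t + k2%:E * (EFin \o f) t))%E).
  apply: le_integral_measurable => //.
  - exact: measurable_funTS.
  - apply: emeasurable_funD; first exact: (measurable_int mu (integrable_cst_oo _ _ _)).
    by apply: measurable_funeM; exact: (measurable_int mu fi).
  move=> t; rewrite /= in_itv/= => /andP[lt tr].
  have tl0 : 0 < t - l by rewrite subr_gt0.
  have -> : (if (t - l) `^ (Q - 1) <= 0 then -oo%E else
      (ln ((t - l) `^ (Q - 1)))%:E) = ((Q - 1) * ln (t - l))%:E.
    by rewrite leNgt powR_gt0//= ln_powR.
  rewrite -EFinM -EFinD lee_fin /k1 /k2.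
  have -> : (r - l) `^ (- e) / s * f t = ((t - l) / (r - l)) `^ e / s.
    by rewrite powR_div ?(ltW tl0)// mulrAC.
  have u0 : 0 < (t - l) / (r - l) by rewrite divr_gt0.
  have := expR_ge1Dx (ln (((t - l) / (r - l)) `^ e)).
  rewrite lnK ?posrE ?powR_gt0// ln_powR ln_div ?posrE// => h.
  rewrite -(ler_pM2r s0).
  have -> : ((Q - 1) * ln (r - l) - s^-1 + ((t - l) / (r - l)) `^ e / s) * s =
      (Q - 1) * ln (r - l) * s - 1 + ((t - l) / (r - l)) `^ e.
    by field; rewrite gt_eqF.
  by move: h; rewrite /e; move: (powR _ _) => Y; lra.
rewrite integralD//; last 2 first.
- exact: integrable_cst_oo.
- exact: integrableZl.
have -> : (\int[mu]_(t in `]l, r[) (EFin \o cst k1) t =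
    \int[mu]_(t in `]l, r[) cst k1%:E t)%E by [].
rewrite integral_cst// integralZl// fE.
rewrite /= lebesgue_measure_itv/= lte_fin lr -EFinB -!EFinM -EFinD lee_fin.
rewrite /k1 /k2 powRN powRD; last by rewrite (gt_eqF rl0) implybT.
rewrite powRr1 ?(ltW rl0)// le_eqVlt; apply/orP; left; apply/eqP.
rewrite (addrC 1 e).
have -> : (Q - 1) / (e + 1) = s^-1 - (s * (e + 1))^-1.
  by rewrite /e; field; rewrite !gt_eqF//; move: e0; rewrite /e; lra.
field.
by rewrite !gt_eqF// ?powR_gt0//; lra.
Qed.

Lemma Cinfty_le p delta I (C : \bar R) : 1 < p -> 1 <= delta ->
  bounded_interval I ->
  (forall w, reverse_holder p delta I w -> (Ainfty_constant I w <= C)%E) ->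
  (Cinfty p delta <= C)%E.
Proof.
move=> p1 d1 bI HC.
have tD := critical_exponent_tangent p1 d1.
have [a [b [l [r [lr IE]]]]] := bounded_interval_itv bI.
rewrite /Cinfty /=; move: (critical_exponent p delta) tD => Q tD.
have [_ _ Q1 _] := tD.
have RH : reverse_holder p delta I (fun t => (t - l) `^ (Q - 1)).
  by rewrite IE; exact: reverse_holder_powR_weight.
apply: le_trans (HC _ RH).
apply: (@le_trans _ _ (average (EFin \o (fun t => (t - l) `^ (Q - 1))%R) I *
  expeR (- average (fun t => lne ((t - l) `^ (Q - 1))%:E) I))%E); last first.
  by apply: ereal_sup_ubound; exists I => //; split.
have rl0 : 0 < r - l by rewrite subr_gt0.
have Q0 : 0 < Q by lra.
have M0 : 0 < Q^-1 * expR (Q - 1) by rewrite mulr_gt0 ?expR_gt0 ?invr_gt0.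
set M := Q^-1 * expR (Q - 1) in M0 *.
apply/lee_subgt0Pr => e e0.
have eM0 : 0 < e / M by rewrite divr_gt0.
(* Small enough that (Q - 1)^2 s <= e / M, so the exponent drops by at most e / M, and M exp (- e /
   M) >= M - e. The summand 1 covers Q = 1. *)
pose s := e / M / ((Q - 1) * (Q - 1) + 1).
have den0 : 0 < (Q - 1) * (Q - 1) + 1.
  by rewrite ltr_wpDl// -expr2 sqr_ge0.
have s0 : 0 < s by rewrite divr_gt0.
have as0 : 0 <= (Q - 1) * s by rewrite mulr_ge0//; lra.
have sE : s * ((Q - 1) * (Q - 1) + 1) = e / M by rewrite divfK// gt_eqF.
have le_exp : M - e <= Q^-1 * expR ((Q - 1) / (1 + (Q - 1) * s)).
  have h1 : Q - 1 - e / M <= (Q - 1) / (1 + (Q - 1) * s).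
    rewrite ler_pdivlMr; last lra.
    have : 0 <= (Q - 1) * s * (e / M) by rewrite mulr_ge0// ltW.
    by rewrite -sE; lra.
  have h2 : M * (1 - e / M) <= M * expR (- (e / M)).
    by rewrite ler_pM2l// expR_ge1Dx.
  have -> : M - e = M * (1 - e / M) by field; rewrite gt_eqF.
  apply: le_trans h2 _; rewrite /M -mulrA -expRD.
  by rewrite ler_pM2l ?invr_gt0// ler_expR.
rewrite -EFinB; apply: (@le_trans _ _ (Q^-1 *
  expR ((Q - 1) / (1 + (Q - 1) * s)))%:E); first by rewrite lee_fin.
have := average_lne_powR_weight_le a b lr Q1 s0.
rewrite -IE -leeN2 -lee_expeR => le.
rewrite [in X in (_ <= X * _)%E]IE average_powR_weight// subrr powR0 ?gt_eqF//.
rewrite subr0.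
have A0 : 0 < (r - l) `^ Q / Q / (r - l) by rewrite !divr_gt0// powR_gt0.
apply: le_trans (lee_wpmul2l _ le); last by rewrite lee_fin ltW.
rewrite /= lee_fin opprB expRD expRN.
have -> : expR ((Q - 1) * ln (r - l)) = (r - l) `^ (Q - 1).
  by rewrite /powR gt_eqF.
have -> : (r - l) `^ Q = (r - l) * (r - l) `^ (Q - 1).
  by rewrite mulr_powRB1// ltW.
rewrite le_eqVlt; apply/orP; left; apply/eqP.
by field; rewrite !gt_eqF// ?powR_gt0.
Qed.

End sharpness_infty.

Theorem theorem1 (R : realType) (I : set R) (p delta : R) :
  bounded_interval I -> 1 < p -> 1 <= delta ->
  [/\ forall w : R -> R, reverse_holder p delta I w ->
        forall q : R, 1 < q -> (Aq_constant I q w <= Cq p delta q)%E,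
      forall w : R -> R, reverse_holder p delta I w ->
        (Ainfty_constant I w <= Cinfty p delta)%E,
      forall q : R, 1 < q -> forall C : \bar R,
        (forall w : R -> R, reverse_holder p delta I w ->
           (Aq_constant I q w <= C)%E) ->
        (Cq p delta q <= C)%E
    & forall C : \bar R,
        (forall w : R -> R, reverse_holder p delta I w ->
           (Ainfty_constant I w <= C)%E) ->
        (Cinfty p delta <= C)%E].
Proof.
move=> bI p1 d1; split.
- by move=> w RH q q1; exact: Aq_constant_le.
- by move=> w RH; exact: Ainfty_constant_le.
- by move=> q q1 C; exact: Cq_le.
- by move=> C; exact: Cinfty_le.
Qed.
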